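(* Let $\Bbbk$ be an algebraically closed field, let $\Gamma\subseteq\mathbb{P}^n_\Bbbk$ be a reduced complete intersection of hypersurfaces of degrees $\mathbf{d}=(d_1,\ldots,d_n)$, $1\le d_1\le\cdots\le d_n$ (so $\Gamma$ consists of $\prod_i d_i$ distinct points), and let $X$ be a hypersurface of degree $D$ with $1\le D<\sigma=\sum_{i=1}^n(d_i-1)$. Set $\tau_-=\lfloor\frac{\sigma+D-1}{2}\rfloor$, $\tau^+=\lceil\frac{\sigma+D-1}{2}\rceil$ and $\delta(\mathbf{d};D)=\prod_{i=1}^n d_i-\sum_{m=D+1}^{\tau_-}\varphi_m-\sum_{m=D+1}^{\tau^+}\varphi_m-1$. If $X$ contains at least $\delta(\mathbf{d};D)$ points of $\Gamma$, then $X$ contains $\Gamma$.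
   Context: Let $\overline{S}=\Bbbk[x_1,\ldots,x_n]$ standard graded, $\operatorname{HF}(M;j)=\dim_\Bbbk M_j$, $(\mathsf{x}^{\mathbf{d}})=(x_1^{d_1},\ldots,x_n^{d_n})$. For $E\le\sigma$ let $U_E$ be the lex-largest monomial ($x_1>\cdots>x_n$) of degree $E$ not in $(\mathsf{x}^{\mathbf{d}})$ and $\mathcal{L}(\mathbf{d};E)=(\mathsf{x}^{\mathbf{d}})+(U_E)$. Define $\varphi_m=\operatorname{HF}(\overline{S}/(\mathsf{x}^{\mathbf{d}});m)-\operatorname{HF}(\overline{S}/\mathcal{L}(\mathbf{d};m-1);m)$ for $2\le m\le\sigma$ and $\varphi_m=0$ otherwise. Empty sums are $0$. *)

(* Defs.v *)
From HB Require Import structures.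
From mathcomp Require Import all_boot all_order all_algebra.
From mathcomp Require Import mpoly.
Unset Printing Implicit Defensive.
Import Order.TTheory GRing.Theory Num.Theory.

(* Projective geometry: P^n over k is represented by nonzero vectors       *)
(* v : 'I_n.+1 -> k up to nonzero scaling; homogeneous forms are elements *)
(* of {mpoly k[n.+1]}.                                                     *)

Local Open Scope ring_scope.

Definition homog_of {N : nat} {k : fieldType} (d : nat) (p : {mpoly k[N]}) : bool :=
  p \is @ishomog1 N k d mdeg.

Definition ppoint {N : nat} {k : fieldType} (v : 'I_N -> k) : Prop :=
  exists i, v i != 0.

Definition proj_eq {N : nat} {k : fieldType} (v w : 'I_N -> k) : Prop :=
  exists c : k, c != 0 /\ forall i, w i = c * v i.

Definition vanishes_at {N : nat} {k : fieldType} (p : {mpoly k[N]}) (v : 'I_N -> k) : Prop :=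
  p.@[v] = 0.

Definition in_zeroset {N n : nat} {k : fieldType} (F : 'I_n -> {mpoly k[N]})
    (v : 'I_N -> k) : Prop :=
  ppoint v /\ forall i, vanishes_at (F i) v.

Definition in_ideal {N n : nat} {k : fieldType} (F : 'I_n -> {mpoly k[N]})
    (G : {mpoly k[N]}) : Prop :=
  exists A : 'I_n -> {mpoly k[N]}, G = \sum_(i < n) A i * F i.

(* Gamma = V(F_1,...,F_n) in P^n is a reduced complete intersection of     *)
(* hypersurfaces of degrees d_1,...,d_n:                                   *)
(*   - each F_i is a form of degree d_i;                                   *)
(*   - the zero locus is zero-dimensional, i.e. finitely many projective   *)
(*     points (n hypersurfaces in P^n, so this is a complete intersection);*)
(*   - the (unmixed, hence saturated) ideal (F_1,...,F_n) is radical,      *)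
(*     i.e. the scheme Gamma is reduced.                                   *)
Definition reduced_complete_intersection {n : nat} {k : fieldType}
    (d : 'I_n -> nat) (F : 'I_n -> {mpoly k[n.+1]}) : Prop :=
  [/\ forall i, homog_of (d i) (F i),
      exists s : seq ('I_n.+1 -> k),
        forall v, in_zeroset F v -> exists2 i, (i < size s)%N & proj_eq (nth (fun _ => 0) s i) v
      & forall (G : {mpoly k[n.+1]}) (m : nat), in_ideal F (G ^+ m) -> in_ideal F G].

(* Combinatorial part: monomials of Sbar = k[x_1..x_n] as exponent vectors *)

Local Close Scope ring_scope.

Definition sigma_d {n : nat} (d : 'I_n -> nat) : nat := \sum_(i < n) (d i - 1).

(* bound for exponents: every monomial outside (x^d) has a_i < d_i <= B *)
Definition expB {n : nat} (d : 'I_n -> nat) : nat := (\sum_(i < n) d i).+1.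

Definition mon {n : nat} (d : 'I_n -> nat) := {ffun 'I_n -> 'I_(expB d)}.

Definition mdegree {n : nat} {d : 'I_n -> nat} (a : mon d) : nat :=
  \sum_(i < n) (a i : nat).

(* a is a monomial not in the ideal (x_1^{d_1},...,x_n^{d_n}) *)
Definition notin_xd {n : nat} {d : 'I_n -> nat} (a : mon d) : bool :=
  [forall i, (a i : nat) < d i].

Definition mdivides {n : nat} {d : 'I_n -> nat} (b a : mon d) : bool :=
  [forall i, (b i : nat) <= a i].

Definition lexle {n : nat} {d : 'I_n -> nat} (b a : mon d) : bool :=
  (b == a) ||
  [exists i : 'I_n, ((b i : nat) < a i) &&
     [forall j : 'I_n, (j < i) ==> ((b j : nat) == a j)]].

Definition adm {n : nat} (d : 'I_n -> nat) (E : nat) (a : mon d) : bool :=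
  notin_xd a && (mdegree a == E).

(* U_E : the lex-largest monomial of degree E not in (x^d)                 *)
(* (it exists whenever E <= sigma; the default is never used then).       *)
Definition U_E {n : nat} (d : 'I_n -> nat) (E : nat) : mon d :=
  odflt [ffun _ => @ord0 (\sum_(i < n) d i)]
    [pick a : mon d | adm d E a && [forall b : mon d, adm d E b ==> lexle b a]].

(* HF(Sbar/(x^d); j) *)
Definition HF_xd {n : nat} (d : 'I_n -> nat) (j : nat) : nat :=
  #|[set a : mon d | adm d j a]|.

(* HF(Sbar/L(d;E); j), L(d;E) = (x^d) + (U_E) *)
Definition HF_L {n : nat} (d : 'I_n -> nat) (E j : nat) : nat :=
  #|[set a : mon d | adm d j a && ~~ mdivides (U_E d E) a]|.

Definition phi {n : nat} (d : 'I_n -> nat) (m : nat) : int :=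
  if (2 <= m) && (m <= sigma_d d) then
    (Posz (HF_xd d m) - Posz (HF_L d m.-1 m))%R
  else 0%R.

Definition delta {n : nat} (d : 'I_n -> nat) (D : nat) : int :=
  let tau_m := (sigma_d d + D - 1)./2 in
  let tau_p := uphalf (sigma_d d + D - 1) in
  (Posz (\prod_(i < n) d i)
   - \sum_(D.+1 <= m < tau_m.+1) phi d m
   - \sum_(D.+1 <= m < tau_p.+1) phi d m - 1)%R.

(* Main.v *)
Require Import Defs.
From HB Require Import structures.
From mathcomp Require Import all_boot all_order all_algebra.
From mathcomp Require Import mpoly.
From Stdlib Require Import Classical ClassicalEpsilon.
From Stdlib Require Import FunctionalExtensionality PropExtensionality.
From mathcomp Require Import zify ring.

(** If the form [G] is nonzero at
    some point of [Gamma], choose a linear form [l] without zeros on the finite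
    set [Gamma].  The ideal [I = (F_1, .., F_n, l)] is then primary to the
    irrelevant ideal, hence an Artinian complete intersection [A = P / I]:
    Gorenstein, with socle degree [sigma] and of length [\prod d_i].  Dividing
    [G] by [l] and multiplying back produces a form [g], nonzero in [A], of
    degree [D] and vanishing on the given points of [Gamma]; their number is at most
    the length of [A / gA].

    It remains to bound [gA] from below.  It is a shift of the Gorenstein ring
    [P / (I : g)], so its Hilbert function [h] is symmetric about
    [(sigma + D) / 2], with value 1 at both ends [D] and [sigma].  Moreover
    [h m >= phi m] for [D < m]: if [t] independent linear forms kill a nonzero
    [u] of degree [m - 1] in [A], then a form of degree [sigma - (m - 1)] lies
    outside [(I, t linear forms)], an ideal containing a complete intersection
    of [t] linear forms and of the [n + 1 - t] forms of largest degree, so that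
    [m - 1] is at least the sum of the [t] smallest [d_i - 1].

    The Nullstellensatz, the regularity of [N] forms in [N] variables without
    common zero, and Gorenstein duality all come from counting dimensions of
    graded pieces. *)

Set Implicit Arguments.
Unset Strict Implicit.
Import Order.TTheory GRing.Theory Num.Theory.
Local Open Scope ring_scope.

(** * Dimensions of subquotients *)

Definition subsp {k : fieldType} {V : lmodType k} (B : V -> Prop) : Prop :=
  B 0 /\ forall c u v, B u -> B v -> B (c *: u + v).

(* [A / B] has dimension [r]; only the elements of [A] are compared modulo [B],
   so [B] need not be contained in [A]. *)
Definition qdim {k : fieldType} {V : lmodType k} (A B : V -> Prop) (r : nat) : Prop :=
  exists e : 'I_r -> V,
    [/\ forall i, A (e i),
        forall c : 'I_r -> k, B (\sum_i c i *: e i) -> forall i, c i = 0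
      & forall u, A u -> exists c : 'I_r -> k, B (u - \sum_i c i *: e i)].

Section Qdim.
Variables (k : fieldType) (V : lmodType k).
Implicit Types (A B C : V -> Prop).

Lemma subspD B u v : subsp B -> B u -> B v -> B (u + v).
Proof. by move=> [_ h] hu hv; have := h 1 _ _ hu hv; rewrite scale1r. Qed.

Lemma subspZ B c u : subsp B -> B u -> B (c *: u).
Proof. by move=> [h0 h] hu; have := h c _ _ hu h0; rewrite addr0. Qed.

Lemma subspN B u : subsp B -> B u -> B (- u).
Proof. by move=> hB hu; rewrite -scaleN1r; exact: subspZ. Qed.

Lemma subspB B u v : subsp B -> B u -> B v -> B (u - v).
Proof. by move=> hB hu hv; apply: subspD => //; exact: subspN. Qed.

Lemma subsp_sum B (I : Type) (s : seq I) (P : pred I) (F : I -> V) :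
  subsp B -> (forall i, P i -> B (F i)) -> B (\sum_(i <- s | P i) F i).
Proof.
move=> hB hF; apply: (big_ind B) => //; first by case: hB.
by move=> u v; exact: subspD.
Qed.

(** If [s < r], the matrix of coefficients of the [e i] on the [f j] has a nonzero vector in its
    left kernel, and this vector is a relation among the [e i] modulo [B]. *)
Lemma steinitz B r s (e : 'I_r -> V) (f : 'I_s -> V) : subsp B ->
  (forall i, exists c : 'I_s -> k, B (e i - \sum_j c j *: f j)) ->
  (forall c : 'I_r -> k, B (\sum_i c i *: e i) -> forall i, c i = 0) -> (r <= s)%N.
Proof.
move=> hB /fin_all_exists [M hM] hind; rewrite leqNgt; apply/negP => lt_sr.
pose A : 'M[k]_(r, s) := \matrix_(i, j) M i j.
have : kermx A != 0.
  rewrite kermx_eq0 /row_free; apply: contraL lt_sr => /eqP <-.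
  by rewrite -leqNgt rank_leq_col.
move=> /rowV0Pn [v /sub_kermxP vA v0].
move/negP: v0; apply; apply/eqP/rowP => i; rewrite mxE.
apply: (hind (fun i => v 0 i)).
have -> : \sum_i v 0 i *: e i = \sum_i v 0 i *: (e i - \sum_j M i j *: f j).
  under [RHS]eq_bigr do rewrite scalerBr scaler_sumr.
  rewrite big_split /= sumrN exchange_big /= [X in _ - X]big1 ?subr0 // => j _.
  under eq_bigr do rewrite scalerA.
  rewrite -scaler_suml; move/rowP: vA => /(_ j); rewrite !mxE => vA.
  rewrite -[RHS](scale0r (f j)) -[in RHS]vA; congr (_ *: _).
  by apply: eq_bigr => i' _; rewrite mxE.
by apply: subsp_sum => // ? _; apply: subspZ.
Qed.

Lemma qdim_le A B r s : subsp B -> qdim A B r ->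
  (exists f : 'I_s -> V, forall u, A u ->
     exists c : 'I_s -> k, B (u - \sum_i c i *: f i)) -> (r <= s)%N.
Proof.
by move=> hB [e [eA eind _]] [f hf]; apply: (steinitz hB (e := e) (f := f)) => // i;
   apply: hf.
Qed.

Lemma qdim_ge A B r s : subsp B -> qdim A B r ->
  (exists f : 'I_s -> V, (forall i, A (f i)) /\
     forall c : 'I_s -> k, B (\sum_i c i *: f i) -> forall i, c i = 0) -> (s <= r)%N.
Proof.
by move=> hB [e [eA _ es]] [f [fA hf]]; apply: (steinitz hB (e := f) (f := e)) => // i;
   apply: es.
Qed.

Lemma qdim_uniq A B r s : subsp B -> qdim A B r -> qdim A B s -> r = s.
Proof.
move=> hB hr hs; apply/eqP; rewrite eqn_leq.
case: (hr) (hs) => [e [eA ei es]] [f [fA fi fs]].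
by apply/andP; split; [apply: (qdim_le hB hr); exists f | apply: (qdim_le hB hs); exists e].
Qed.

Lemma indep_extend A B r (e : 'I_r -> V) u : subsp B ->
  (forall i, A (e i)) -> (forall c : 'I_r -> k, B (\sum_i c i *: e i) -> forall i, c i = 0) ->
  A u -> ~ (exists c : 'I_r -> k, B (u - \sum_i c i *: e i)) ->
  exists e' : 'I_r.+1 -> V, (forall i, A (e' i)) /\
    (forall c : 'I_r.+1 -> k, B (\sum_i c i *: e' i) -> forall i, c i = 0).
Proof.
move=> hB eA ei uA nu.
pose e' (i : 'I_r.+1) := if unlift ord0 i is Some j then e j else u.
have e'E c : \sum_i c i *: e' i = c ord0 *: u + \sum_i c (lift ord0 i) *: e i.
  rewrite big_ord_recl {1}/e' unlift_none; congr (_ + _).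
  by apply: eq_bigr => i _; rewrite /e' liftK.
exists e'; split=> [i|c]; first by rewrite /e'; case: unliftP.
rewrite e'E => hc; have c0 : c ord0 = 0.
  apply/eqP/negPn/negP => c0; apply: nu.
  exists (fun i => - (c ord0)^-1 * c (lift ord0 i)).
  have := subspZ (c ord0)^-1 hB hc; rewrite scalerDr scalerA mulVf // scale1r.
  rewrite scaler_sumr -sumrN; congr B; congr (_ + _).
  by apply: eq_bigr => i _; rewrite scalerA mulNr scaleNr opprK.
move: hc; rewrite c0 scale0r add0r => /(ei (fun i => c (lift ord0 i))) hc i.
by case: (unliftP ord0 i) => [j|] ->.
Qed.

Lemma qdim_ex A B s : subsp B ->
  (exists f : 'I_s -> V, forall u, A u ->
     exists c : 'I_s -> k, B (u - \sum_i c i *: f i)) -> exists r, qdim A B r.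
Proof.
move=> hB [f hf].
(* [m] bounds how often an independent family can still be extended: [steinitz] allows at most [s]
   members. *)
suff H m : forall r (e : 'I_r -> V), (s < r + m)%N -> (forall i, A (e i)) ->
    (forall c : 'I_r -> k, B (\sum_i c i *: e i) -> forall i, c i = 0) ->
    exists r, qdim A B r.
  by apply: (H s.+1 0%N (fun=> 0)) => //; [case | move=> c _; case].
elim: m => [|m IHm] r e lt_sr eA ei.
  have := steinitz (e := e) (f := f) hB (fun i => hf _ (eA i)) ei.
  by rewrite leqNgt -(addn0 r) lt_sr.
case: (classic (forall u, A u -> exists c : 'I_r -> k, B (u - \sum_i c i *: e i))).
  by move=> es; exists r, e.
move=> /not_all_ex_not [u hu]; have [uA nu] := imply_to_and _ _ hu.
have [e' [e'A e'i]] := indep_extend hB eA ei uA nu.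
by apply: (IHm _ e') => //; rewrite addSnnS.
Qed.

End Qdim.

(* Additivity along [0 -> A/B -> A'/B' -> A'/B'' -> 0], the first map being
   induced by [f]. *)
Lemma qdim_exact (k : fieldType) (V W : lmodType k) (f : {linear V -> W}) (A B : V -> Prop)
    (A' B' B'' : W -> Prop) r s :
  subsp B' ->
  (forall u, A u -> A' (f u)) -> (forall u, B u -> B' (f u)) ->
  subsp A -> (forall u, A u -> B' (f u) -> B u) ->
  (forall u, B' u -> B'' u) -> (forall u, A u -> B'' (f u)) -> subsp B'' ->
  (forall u, A' u -> B'' u -> exists2 a, A a & B' (u - f a)) -> subsp A' ->
  qdim A B r -> qdim A' B'' s -> qdim A' B' (r + s).
Proof.
move=> hB' fA fB sA finj B'B'' AB'' hB'' hex sA' [e [eA ei es]] [e' [e'A e'i e's]].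
pose g (i : 'I_(r + s)) := match split i with inl i => f (e i) | inr j => e' j end.
have gE c : \sum_i c i *: g i =
   f (\sum_i c (lshift s i) *: e i) + \sum_j c (rshift r j) *: e' j.
  rewrite big_split_ord linear_sum; congr (_ + _); apply: eq_bigr => i _.
    by rewrite /g (unsplitK (inl _)) linearZ.
  by rewrite /g (unsplitK (inr _)).
exists g; split.
- by move=> i; rewrite /g; case: split => j; auto.
- move=> c; rewrite gE => hc.
  have Ae : A (\sum_i c (lshift s i) *: e i).
    by apply: subsp_sum => // i _; apply: subspZ.
  have c2 : forall j, c (rshift r j) = 0.
    apply: (e'i (fun j => c (rshift r j))).
    have := subspB hB'' (B'B'' _ hc) (AB'' _ Ae).
    by rewrite addrAC subrr add0r.
  have c1 : forall j, c (lshift s j) = 0.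
    apply: (ei (fun j => c (lshift s j))); apply: finj => //.
    by move: hc; rewrite [X in _ + X]big1 ?addr0 // => j _; rewrite c2 scale0r.
  by move=> i; case: (split_ordP i) => j ->.
- move=> u uA; have [d hd] := e's _ uA.
  have uA' : A' (u - \sum_i d i *: e' i).
    by apply: subspB => //; apply: subsp_sum => // i _; apply: subspZ.
  have [a aA ha] := hex _ uA' hd; have [c hc] := es _ aA.
  exists (fun i => match split i with inl i => c i | inr j => d j end); rewrite gE.
  rewrite [f _ + _](_ : _ = f (\sum_i c i *: e i) + \sum_j d j *: e' j); last first.
    congr (f _ + _); apply: eq_bigr => i _; first by rewrite (unsplitK (inl _)).
    by rewrite (unsplitK (inr _)).
  have := subspD hB' ha (fB _ hc); rewrite linearB /=; congr B'.
  by rewrite addrA subrK opprD addrA addrAC.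
Qed.

(** * Graded ideals and Hilbert functions *)

Definition mulby {k : fieldType} {N : nat} (a u : {mpoly k[N]}) : {mpoly k[N]} := a * u.

Lemma mulby_linear {k : fieldType} {N : nat} (a : {mpoly k[N]}) : linear (mulby a).
Proof. by move=> c u v; rewrite /mulby mulrDr scalerAr. Qed.

HB.instance Definition _ (k : fieldType) (N : nat) (a : {mpoly k[N]}) :=
  GRing.isLinear.Build k {mpoly k[N]} {mpoly k[N]} _ (mulby a) (mulby_linear a).

Section Ideals.
Variables (k : fieldType) (N : nat).
Local Notation P := {mpoly k[N]}.
Implicit Types (J : P -> Prop) (a b u v f : P).

Definition gideal J : Prop :=
  [/\ J 0, forall u v, J u -> J v -> J (u + v), forall a u, J u -> J (a * u)
    & forall j u, J u -> J (pihomog mdeg j u)].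

(** The ideal [J + (f)]; [colon J f] is the ideal quotient [(J : f)]. *)
Definition adj J f : P -> Prop := fun u => exists b, J (u - b * f).
Definition colon J f : P -> Prop := fun u => J (f * u).
Definition homd j : P -> Prop := fun u => u \is j.-homog.

(** The Hilbert function of [P / J]. As [qdim] is a relation, the value is picked by [epsilon];
    [HFPs] shows that it is the dimension when [J] is a subspace. *)
Definition HF J (j : nat) : nat := epsilon (inhabits 0%N) (qdim (homd j) J).

(** [J] contains a power of the irrelevant ideal, so [P / J] is Artinian (possibly zero). *)
Definition mprim J : Prop := exists M, forall j u, (M <= j)%N -> homd j u -> J u.

Lemma gi0 J : gideal J -> J 0. Proof. by case. Qed.
Lemma giD J u v : gideal J -> J u -> J v -> J (u + v). Proof. by case=> _ h _ _; exact: h. Qed.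
Lemma giM J a u : gideal J -> J u -> J (a * u). Proof. by case=> _ _ h _; exact: h. Qed.
Lemma giMr J a u : gideal J -> J u -> J (u * a). Proof. by rewrite mulrC; exact: giM. Qed.
Lemma giH J j u : gideal J -> J u -> J (pihomog mdeg j u).
Proof. by case=> _ _ _ h; exact: h. Qed.

Lemma gi_subsp J : gideal J -> subsp J.
Proof.
move=> hJ; split=> [|c u v hu hv]; first exact: gi0.
by apply: giD => //; rewrite -mul_mpolyC; exact: giM.
Qed.

Lemma giB J u v : gideal J -> J u -> J v -> J (u - v).
Proof. by move=> /gi_subsp; exact: subspB. Qed.
Lemma giN J u : gideal J -> J u -> J (- u).
Proof. by move=> /gi_subsp; exact: subspN. Qed.
Lemma giZ J c u : gideal J -> J u -> J (c *: u).
Proof. by move=> /gi_subsp; exact: subspZ. Qed.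

Lemma gi_eqm J u v : gideal J -> J (u - v) -> J v -> J u.
Proof. by move=> hJ h1 h2; rewrite -(subrK v u); exact: giD. Qed.

Lemma hom_subsp j : subsp (homd j).
Proof. by split=> [|c u v hu hv]; rewrite /homd ?rpred0 // rpredD // rpredZ. Qed.

Lemma homM i j u v : homd i u -> homd j v -> homd (i + j) (u * v).
Proof. exact: dhomogM. Qed.
Lemma hom_X i : homd 1 ('X_i : P). Proof. by rewrite /homd dhomogX /= mdeg1. Qed.
Lemma hom_1 : homd 0 (1 : P). Proof. exact: dhomog1. Qed.
Lemma hom_exp i u e : homd i u -> homd (i * e) (u ^+ e).
Proof. exact: dhomogMn. Qed.

Lemma hom_exp1 u e : homd 1 u -> homd e (u ^+ e).
Proof. by move=> hu; have := hom_exp e hu; rewrite mul1n. Qed.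

Lemma pihomogM d j b f : homd d f ->
  pihomog mdeg j (b * f) = if (d <= j)%N then pihomog mdeg (j - d) b * f else 0.
Proof.
move=> hf; rewrite [b in LHS]mpolyE mulr_suml raddf_sum /=.
case: leqP => [le_dj|lt_jd].
  rewrite [b in RHS]mpolyE raddf_sum mulr_suml; apply: eq_bigr => m _ /=.
  rewrite -scalerAl !linearZ /= -scalerAl; congr (_ *: _); rewrite pihomogX.
  have hm : homd (mdeg m + d) ('X_[m] * f) by apply: homM => //; rewrite /homd dhomogX.
  case: eqP => [e|ne].
    by apply: pihomog_dE; move: hm; rewrite e subnK.
  rewrite mul0r; apply: (pihomog_ne0 _ hm); apply/eqP => e; apply: ne.
  by rewrite -e addnK.
apply: big1 => m _; rewrite -scalerAl linearZ /=.
have hm : homd (mdeg m + d) ('X_[m] * f) by apply: homM => //; rewrite /homd dhomogX.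
by rewrite (pihomog_ne0 _ hm) ?scaler0 //; apply/eqP => e; lia.
Qed.

Lemma adj_gideal J d f : gideal J -> homd d f -> gideal (adj J f).
Proof.
move=> hJ hf; split.
- by exists 0; rewrite mul0r subr0; exact: gi0.
- move=> u v [b hb] [c hc]; exists (b + c); have := giD hJ hb hc; congr J.
  by ring.
- move=> a u [b hb]; exists (a * b); have := giM a hJ hb; congr J.
  by ring.
- move=> j u [b hb]; have := giH j hJ hb; rewrite linearB /= (pihomogM _ _ hf).
  by case: leqP => _ h; [eexists; exact: h | exists 0; rewrite mul0r].
Qed.

Lemma colon_gideal J d f : gideal J -> homd d f -> gideal (colon J f).
Proof.
move=> hJ hf; split; rewrite /colon.
- by rewrite mulr0; exact: gi0.
- by move=> u v hu hv; rewrite mulrDr; exact: giD.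
- by move=> a u hu; rewrite mulrCA; exact: giM.
- move=> j u hu; have := giH (j + d) hJ hu.
  by rewrite mulrC (pihomogM _ _ hf) leq_addl addnK mulrC.
Qed.

Lemma sub_adj J f u : gideal J -> J u -> adj J f u.
Proof. by move=> hJ hu; exists 0; rewrite mul0r subr0. Qed.
Lemma adj_self J f : gideal J -> adj J f f.
Proof. by move=> hJ; exists 1; rewrite mul1r subrr; exact: gi0. Qed.
Lemma sub_colon J f u : gideal J -> J u -> colon J f u.
Proof. by move=> hJ; exact: giM. Qed.

Lemma adj_min J J' f : gideal J' -> (forall u, J u -> J' u) -> J' f ->
  forall u, adj J f u -> J' u.
Proof. by move=> h1 h2 h3 u [b /h2]; move/gi_eqm; apply => //; exact: giM. Qed.

(** The degree [j] component of the relation has a homogeneous cofactor. Since [j - d] is truncated,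
    the case [j < d] is recorded as [b = 0]. *)
Lemma adj_hom J d f j u : gideal J -> homd d f -> homd j u -> adj J f u ->
  exists b, [/\ homd (j - d) b, (j < d)%N -> b = 0 & J (u - b * f)].
Proof.
move=> hJ hf hu [b hb]; exists (if (d <= j)%N then pihomog mdeg (j - d) b else 0).
have := giH j hJ hb; rewrite linearB /= (pihomog_dE hu) (pihomogM _ _ hf).
by case: leqP => _; rewrite ?mul0r; split=> //; rewrite /homd ?rpred0 //; exact: pihomogP.
Qed.

Lemma pred_ext J J' : (forall u, J u <-> J' u) -> J = J'.
Proof.
by move=> h; apply: functional_extensionality => u; apply: propositional_extensionality.
Qed.

Lemma adjC J a b : adj (adj J a) b = adj (adj J b) a.
Proof.
by apply: pred_ext => u; split=> [] [c [d h]]; exists d, c; rewrite addrAC.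
Qed.

Lemma msize_hom j u : homd j u -> (msize u <= j.+1)%N.
Proof.
move=> /dhomogP h; rewrite msizeE; apply/bigmax_leqP_seq => m hm _.
by rewrite ltnS h.
Qed.

Lemma hom_span j : exists s (f : 'I_s -> P), forall u, homd j u ->
  exists c : 'I_s -> k, u = \sum_i c i *: f i.
Proof.
exists #|{: 'X_{1..N < j.+1}}|, (fun i => 'X_[bmnm (enum_val i)]) => u /msize_hom hu.
exists (fun i => u@_(bmnm (enum_val i))); rewrite {1}(mpolywE hu).
by rewrite (reindex (@enum_val _ predT)) //=; exact: (onW_bij _ (@enum_val_bij _)).
Qed.

Lemma HFP0 J j (A : P -> Prop) : subsp J -> (forall u, A u -> homd j u) ->
  exists r, qdim A J r.
Proof.
move=> hJ hA; have [s [f hf]] := hom_span j.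
apply: (qdim_ex (s := s) hJ); exists f => u /hA /hf [c ->].
by exists c; rewrite subrr; case: hJ.
Qed.

Lemma HFPs J j : subsp J -> qdim (homd j) J (HF J j).
Proof.
move=> hJ; apply: (@epsilon_spec _ (inhabits 0%N) (qdim (homd j) J)).
exact: (HFP0 (j := j)).
Qed.

Lemma HFP J j : gideal J -> qdim (homd j) J (HF J j).
Proof. by move=> /gi_subsp; exact: HFPs. Qed.

(** Dimension count in [0 -> P/(J : f) (-d) -> P/J -> P/(J + (f)) -> 0], the first map being
    multiplication by [f]. *)
Lemma HF_exact J d f j : gideal J -> homd d f ->
  HF J (j + d) = (HF (colon J f) j + HF (adj J f) (j + d))%N.
Proof.
move=> hJ hf; have hc := colon_gideal hJ hf; have ha := adj_gideal hJ hf.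
apply: (qdim_uniq (gi_subsp hJ) (HFP _ hJ)).
apply: (qdim_exact (f := mulby f) _ _ _ _ _ _ _ _ _ _ (HFP j hc) (HFP _ ha));
  rewrite /mulby; try exact: gi_subsp; try exact: hom_subsp.
- by move=> u hu; rewrite addnC; exact: homM.
- by [].
- by [].
- by move=> u; exact: sub_adj.
- by move=> u _; apply: giMr => //; exact: adj_self.
- move=> u hu au; have [b [hb _ hJb]] := adj_hom hJ hf hu au.
  by exists b; [rewrite addnK in hb | rewrite /= /mulby mulrC].
Qed.

Lemma HF_adj_lt J d f j : gideal J -> homd d f -> (j < d)%N -> HF (adj J f) j = HF J j.
Proof.
move=> hJ hf lt_jd; have ha := adj_gideal hJ hf.
apply: (qdim_uniq (gi_subsp ha) (HFP _ ha)).
have [e [eA ei es]] := HFP j hJ; exists e; split => //.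
- move=> c hc; apply: ei.
  have hu : homd j (\sum_i c i *: e i).
    by apply: subsp_sum => [|i _]; [exact: hom_subsp | apply: subspZ => //; exact: hom_subsp].
  by have [b [_ /(_ lt_jd) ->]] := adj_hom hJ hf hu hc; rewrite mul0r subr0.
- by move=> u /es [c hc]; exists c; exact: sub_adj.
Qed.

Lemma HF_mono_subsp J J' j : subsp J -> subsp J' -> (forall u, homd j u -> J u -> J' u) ->
  (HF J' j <= HF J j)%N.
Proof.
move=> hJ hJ' sJ; have [e [eA ei es]] := HFPs j hJ.
apply: (qdim_le hJ' (HFPs j hJ')); exists e => u hu.
have [c hc] := es _ hu; exists c; apply: sJ => //.
apply: subspB => //; first exact: hom_subsp.
by apply: subsp_sum => [|i _]; [exact: hom_subsp | apply: subspZ => //; exact: hom_subsp].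
Qed.

Lemma HF_mono J J' j : gideal J -> gideal J' -> (forall u, homd j u -> J u -> J' u) ->
  (HF J' j <= HF J j)%N.
Proof. by move=> /gi_subsp hJ /gi_subsp hJ'; exact: HF_mono_subsp. Qed.

(** The degree [j] part of [J'/J] has as dimension the difference of the two Hilbert functions,
    which is 0. *)
Lemma HF_mono_eq J J' j : gideal J -> gideal J' -> (forall u, J u -> J' u) ->
  HF J' j = HF J j -> forall u, homd j u -> J' u -> J u.
Proof.
move=> hJ hJ' sJ eqH.
pose A u := homd j u /\ J' u.
have sA : subsp A.
  split; first by split; [case: (hom_subsp j) | exact: gi0].
  move=> c u v [h1 h2] [h3 h4]; split; first by apply: (proj2 (hom_subsp j)).
  by apply: (proj2 (gi_subsp hJ')).
have [r hr] : exists r, qdim A J r by apply: (HFP0 (j := j)) (gi_subsp hJ) _ => // u [].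
have : qdim (homd j) J (r + HF J' j).
  apply: (qdim_exact (f := idfun) _ _ _ _ _ _ _ _ _ _ hr (HFP j hJ')) => //=;
    try exact: gi_subsp; try exact: hom_subsp.
  - by move=> u [].
  - by move=> u [].
  - by move=> u h1 h2; exists u => //; rewrite subrr; exact: gi0.
move=> /(qdim_uniq (gi_subsp hJ) (HFP j hJ)); rewrite eqH => e0.
have r0 : r = 0%N by lia.
move: hr; rewrite r0 => -[e [_ _ es]] u h1 h2.
by have [//|c] := es u _; rewrite big_ord0 subr0.
Qed.

Lemma HF_eq0 J j : gideal J -> HF J j = 0%N -> forall u, homd j u -> J u.
Proof.
by move=> hJ h0 u hu; have := HFP j hJ; rewrite h0 => -[e [_ _ /(_ _ hu) [c]]];
   rewrite big_ord0 subr0.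
Qed.

Lemma HF_0 J j : gideal J -> (forall u, homd j u -> J u) -> HF J j = 0%N.
Proof.
move=> hJ h; apply/eqP; rewrite -leqn0.
apply: (qdim_le (gi_subsp hJ) (HFP j hJ)); exists (fun=> 0) => u hu.
by exists (fun=> 0); rewrite big_ord0 subr0; exact: h.
Qed.

Lemma mprimP J : gideal J -> mprim J -> exists M, forall j, (M <= j)%N -> HF J j = 0%N.
Proof. by move=> hJ [M h]; exists M => j hj; apply: HF_0 => // u; exact: h. Qed.

Lemma mprim_sub J J' : (forall u, J u -> J' u) -> mprim J -> mprim J'.
Proof. by move=> h [M hM]; exists M => j u h1 h2; apply: h; exact: (hM j). Qed.

End Ideals.

(** * The Nullstellensatz *)

Section Null.
Variables (N : nat).

Lemma mon_step (k : fieldType) j (m : 'X_{1..N}) : mdeg m = j.+1 ->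
  exists i (m' : 'X_{1..N}), mdeg m' = j /\ 'X_[m] = 'X_i * 'X_[m'] :> {mpoly k[N]}.
Proof.
move=> hm; case: (pickP (fun i => m i != 0%N)) => [i hi|h]; last first.
  by move: hm; rewrite mdegE big1 // => i _; apply/eqP/negPn; rewrite h.
have le : (U_(i) <= m)%MM by rewrite lep1mP.
exists i, (m - U_(i))%MM; split; last by rewrite -mpolyXD addmC submK.
by have := mdegD (m - U_(i))%MM U_(i)%MM; rewrite submK // mdeg1 hm addn1 => -[<-].
Qed.

Lemma homd_ind (k : fieldType) j (Q : {mpoly k[N]} -> Prop) : subsp Q ->
  (forall m, mdeg m = j -> Q 'X_[m]) -> forall u, homd j u -> Q u.
Proof.
move=> hQ hm u /dhomogP hu; rewrite [u]mpolyE big_seq.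
by apply: subsp_sum => // m /hu hj; apply: subspZ => //; exact: hm.
Qed.

Lemma gen_all (k : fieldType) (J : {mpoly k[N]} -> Prop) j : gideal J ->
  (forall i, J 'X_i) -> forall u, homd j.+1 u -> J u.
Proof.
move=> hJ hX; apply: homd_ind; first exact: gi_subsp.
by move=> m /(mon_step k) [i [m' [_ ->]]]; exact: giMr.
Qed.

Lemma homX_span (k : fieldType) (u : {mpoly k[N]}) : homd 1 u ->
  u = \sum_i u@_U_(i) *: 'X_i.
Proof.
move: u; apply: (@homd_ind _ 1 (fun u => u = \sum_i u@_U_(i) *: 'X_i)) => [|m hm].
  split; first by rewrite big1 // => i _; rewrite mcoeff0 scale0r.
  move=> c u' v {1}-> {1}->; rewrite scaler_sumr -big_split /=; apply: eq_bigr => i _.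
  by rewrite scalerA -scalerDl mcoeffD mcoeffZ.
move/eqP: hm => /mdeg1P [i /eqP ->].
rewrite (bigD1 i) //= mcoeffXU eqxx scale1r big1 ?addr0 // => i' ne.
by rewrite mcoeffXU eq_sym (negbTE ne) scale0r.
Qed.

Lemma hom0C (k : fieldType) (u : {mpoly k[N]}) : homd 0 u -> exists c, u = c%:MP.
Proof.
move: u; apply: (@homd_ind _ 0 (fun u => exists c, u = c%:MP)) => [|m /eqP].
  split=> [|c u' v [a ->] [b ->]]; first by exists 0.
  by exists (c * a + b); rewrite mpolyCD mpolyCM mul_mpolyC.
by rewrite mdeg_eq0 => /eqP ->; exists 1; rewrite mpolyX0.
Qed.

Definition nozero (k : fieldType) (J : {mpoly k[N]} -> Prop) : Prop :=
  forall v : 'I_N -> k, (exists i, v i != 0) ->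
    exists e p, [/\ homd e p, J p & p.@[v] != 0].

Lemma nozero_sub (k : fieldType) (J J' : {mpoly k[N]} -> Prop) :
  (forall u, J u -> J' u) -> nozero J -> nozero J'.
Proof. by move=> h hJ v /hJ [e [p [h1 h2 h3]]]; exists e, p; split; auto. Qed.

Lemma noninc_stable (f : nat -> nat) M : (forall j, (M <= j)%N -> (f j.+1 <= f j)%N) ->
  exists2 j0, (M <= j0)%N & forall j, (j0 <= j)%N -> f j.+1 = f j.
Proof.
suff H n : forall M, (f M <= n)%N -> (forall j, (M <= j)%N -> (f j.+1 <= f j)%N) ->
    exists2 j0, (M <= j0)%N & forall j, (j0 <= j)%N -> f j.+1 = f j.
  exact: (H (f M)).
have dec K : (forall j, (K <= j)%N -> (f j.+1 <= f j)%N) ->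
    forall j, (K <= j)%N -> (f j <= f K)%N.
  move=> h; elim=> [|j IH]; first by rewrite leqn0 => /eqP ->.
  rewrite leq_eqVlt => /orP [/eqP -> //|]; rewrite ltnS => le.
  exact: leq_trans (h _ le) (IH le).
elim: n => [|n IHn] K fK h.
  exists K => // j hj; have := dec K h j hj; have := dec K h j.+1 (leqW hj).
  by lia.
case: (classic (exists2 j, (K <= j)%N & (f j.+1 < f j)%N)) => [[j hj lt]|no].
  have [|i hi|j0 h0 hs] := IHn j.+1; first by have := dec K h j hj; lia.
    by apply: h; apply: leq_trans hi; apply: leqW.
  by exists j0 => //; lia.
exists K => // j hj; apply/eqP; rewrite eqn_leq h //= leqNgt; apply/negP => lt.
by apply: no; exists j.
Qed.

(** In large degree multiplication by [x] is onto modulo [J], so [HF J] is nonincreasing there and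
    finally constant; a surjection between spaces of equal dimension is injective. *)
Lemma surj_inj (k : fieldType) (J : {mpoly k[N]} -> Prop) x : gideal J -> homd 1 x ->
  mprim (adj J x) ->
  exists j0, forall j, (j0 <= j)%N ->
    HF (adj J x) j.+1 = 0%N /\ forall u, homd j u -> J (x * u) -> J u.
Proof.
move=> hJ hx; have ha := adj_gideal hJ hx; have hc := colon_gideal hJ hx.
move=> /(mprimP ha) [M hM].
have ex j : HF J j.+1 = (HF (colon J x) j + HF (adj J x) j.+1)%N.
  by rewrite -addn1 (HF_exact j hJ hx).
have le j : (HF (colon J x) j <= HF J j)%N by apply: HF_mono => // u _; exact: sub_colon.
have [j|j0 h0 hs] := @noninc_stable (HF J) M.
  by move=> hj; rewrite ex (hM j.+1) ?addn0 // leqW.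
exists j0 => j hj; have z : HF (adj J x) j.+1 = 0%N by apply: hM; lia.
split=> // u hu hxu; apply: (HF_mono_eq (j := j) hJ hc) (hxu) => //.
  by move=> v; exact: sub_colon.
have e1 := hs _ hj; have e2 := ex j; lia.
Qed.

(* For [j] large, multiplication by [x] is a bijection [P_j/J_j -> P_(j+1)/J_(j+1)];
   an eigenvector of [x^-1 y] on [P_j/J_j] is killed by [y - a x], which is then
   not surjective either. *)
Lemma eigen_drop (k : closedFieldType) (J : {mpoly k[N]} -> Prop) x y : gideal J ->
  ~ mprim J -> homd 1 x -> homd 1 y -> mprim (adj J x) ->
  exists a, ~ mprim (adj J (y - a *: x)).
Proof.
move=> hJ nJ hx hy hax; apply: NNPP => /not_ex_all_not no.
have [j0 h0] := surj_inj hJ hx hax.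
have [j1 [j01 nz]] : exists j, (j0 <= j)%N /\ HF J j <> 0%N.
  apply: NNPP => no'; apply: nJ; exists j0 => j u hj hu.
  apply: (HF_eq0 hJ _ hu); apply/eqP/negPn/negP => /eqP nz.
  by apply: no'; exists j.
(* Injectivity of [x] from degree [j0] on carries a nonzero class of degree [j1] to every higher
   degree. *)
have nzj j : (j1 <= j)%N -> HF J j <> 0%N.
  move=> hj e0; apply: nz; apply: HF_0 => // u hu.
  have : J (x ^+ (j - j1) * u).
    apply: (HF_eq0 hJ e0); rewrite -[X in homd X](subnK hj); apply: homM => //.
    by exact: hom_exp1.
  elim: (j - j1)%N => [|i IH]; first by rewrite expr0 mul1r.
  rewrite exprS -mulrA => h; apply: IH; apply: (proj2 (h0 (i + j1)%N _) _ _ h); first by lia.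
  by apply: homM => //; exact: hom_exp1.
have key j : (j1 <= j)%N -> exists a u, [/\ homd j u, ~ J u & J ((y - a *: x) * u)].
  move=> hj; have [e [eA ei es]] := HFP j hJ.
  have ha := adj_gideal hJ hx.
  have hT : forall i, exists c : 'I_(HF J j) -> k, J (y * e i - x * \sum_l c l *: e l).
    move=> i; have hye : homd j.+1 (y * e i) by rewrite -add1n; exact: homM.
    have e0 : HF (adj J x) j.+1 = 0%N by apply: (proj1 (h0 j _)); lia.
    have [b [hb _ hJb]] := adj_hom hJ hx hye (HF_eq0 ha e0 hye).
    rewrite subn1 /= in hb; have [c hc] := es _ hb; exists c.
    have := giD hJ hJb (giM x hJ hc); congr J.
    by rewrite mulrBr addrA (mulrC b) subrK.
  have [T hTT] := fin_all_exists hT.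
  (* [A] represents [x^-1 y] on the basis [e]; its characteristic polynomial has degree
     [HF J j > 0], hence a root. *)
  pose A : 'M[k]_(HF J j) := \matrix_(i, l) T i l.
  have /closed_rootP [a ra] : size (char_poly A) != 1%N.
    by rewrite size_char_poly eqSS; apply/eqP; exact: nzj.
  rewrite -eigenvalue_root_char in ra; have /eigenvalueP [v vA v0] := ra.
  pose u := \sum_i v 0 i *: e i.
  exists a, u; split.
  - by apply: subsp_sum => [|i _]; [exact: hom_subsp | apply: subspZ => //; exact: hom_subsp].
  - move=> Ju; move/negP: v0; apply; apply/eqP/rowP => i; rewrite mxE.
    exact: (ei (fun i => v 0 i) Ju).
  - have -> : (y - a *: x) * u = \sum_i v 0 i *: (y * e i - x * \sum_l T i l *: e l).
      under eq_bigr do rewrite scalerBr.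
      rewrite big_split /= sumrN mulrBl; congr (_ - _).
        by rewrite mulr_sumr; apply: eq_bigr => i _; rewrite scalerAr.
      have -> : a *: x * u = x * (\sum_l (v *m A) 0 l *: e l).
        rewrite -scalerAl scalerAr; congr (_ * _).
        by rewrite vA scaler_sumr; apply: eq_bigr => i _; rewrite mxE scalerA.
      under [RHS]eq_bigr do rewrite scalerAr scaler_sumr.
      rewrite -mulr_sumr exchange_big /=; congr (_ * _); apply: eq_bigr => l _.
      rewrite mxE scaler_suml; apply: eq_bigr => i _.
      by rewrite scalerA mxE.
    by apply: subsp_sum => [|i _]; [exact: gi_subsp | apply: giZ => //; exact: hTT].
have hyx a : homd 1 (y - a *: x).
  apply: subspB => //; first exact: hom_subsp.
  by apply: subspZ => //; exact: hom_subsp.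
have [a [u [hu nu Ju]]] := key j1 (leqnn _).
(* Powers of [x] move the kernel vector of [y - a x] to every large degree, where [surj_inj] would
   make [y - a x] injective. *)
have : exists a, exists j2, forall j, (j2 <= j)%N ->
    exists u, [/\ homd j u, ~ J u & J ((y - a *: x) * u)].
  exists a, j1 => j hj; exists (x ^+ (j - j1) * u); split.
  - rewrite -[X in homd X](subnK hj); apply: homM => //.
    by exact: hom_exp1.
  - elim: (j - j1)%N => [|i IH]; first by rewrite expr0 mul1r.
    rewrite exprS -mulrA => h; apply: IH; apply: (proj2 (h0 (i + j1)%N _) _ _ h); first by lia.
    by apply: homM => //; exact: hom_exp1.
  - by rewrite mulrCA; exact: giM.
move=> [b [j2 hb]]; have /NNPP hmb := no b.
have [j3 h3] := surj_inj hJ (hyx b) hmb.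
have [w [hw nw Jw]] := hb (maxn j2 j3) (leq_maxl _ _).
by apply: nw; apply: (proj2 (h3 _ (leq_maxr j2 j3))).
Qed.

(** Induction on [HF J 1]. If [J] were not primary to the irrelevant ideal, adjoining any linear
    form outside [J] would make it so; [eigen_drop] then puts some [y - a x] into [J] for each [y].
    Hence one form [x] spans the linear forms modulo [J], and the ratios [X_i / x] are the
    coordinates of a common zero, unless a power of [x] lies in [J]. *)
Lemma nullstellensatz (k : closedFieldType) (J : {mpoly k[N]} -> Prop) :
  gideal J -> nozero J -> mprim J.
Proof.
move: {-1}(HF J 1) (leqnn (HF J 1)) => s; elim: s J => [|s IH] J.
  rewrite leqn0 => /eqP h0 hJ _; exists 1%N => -[|j] // u _.
  by apply: gen_all => // i; apply: (HF_eq0 hJ h0); exact: hom_X.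
move=> hs hJ nJ; apply: NNPP => npJ.
have [x [hx nx]] : exists x, homd 1 x /\ ~ J x.
  apply: NNPP => no; apply: npJ; exists 1%N => -[|j] // u _.
  apply: gen_all => // i; apply: NNPP => ni; apply: no.
  by exists 'X_i; split=> //; exact: hom_X.
have adjp z : homd 1 z -> ~ J z -> mprim (adj J z).
  move=> hz nz; apply: IH; last by apply: nozero_sub nJ => u; exact: sub_adj.
    have := HF_exact 0 hJ hz; rewrite add0n => e1.
    suff : HF (colon J z) 0 <> 0%N by lia.
    move=> /(HF_eq0 (colon_gideal hJ hz)) /(_ 1 (hom_1 k N)).
    by rewrite /colon mulr1.
  exact: adj_gideal hJ hz.
case: (classic (exists y, homd 1 y /\ ~ adj J x y)) => [[y [hy ny]]|no].
  have [a] := eigen_drop hJ npJ hx hy (adjp x hx nx).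
  apply; apply: adjp.
    apply: subspB => //; first exact: hom_subsp.
    by apply: subspZ => //; exact: hom_subsp.
  by move=> h; apply: ny; exists a%:MP; rewrite mul_mpolyC.
have hXi (i : 'I_N) : exists c, J ('X_i - c *: x).
  have : adj J x 'X_i by apply: NNPP => n; apply: no; exists 'X_i; split=> //; exact: hom_X.
  move=> /(adj_hom hJ hx (hom_X k i)) [b [hb _ hJb]].
  have [c eb] := hom0C hb; exists c.
  by move: hJb; rewrite eb mul_mpolyC.
have [a ha] := fin_all_exists hXi.
have hp e : forall p, homd e p -> J (p - p.@[a] *: x ^+ e).
  apply: (@homd_ind _ e (fun p => J (p - p.@[a] *: x ^+ e))).
    split; first by rewrite meval0 scale0r subrr; exact: gi0.
    move=> c u v hu hv; have := giD hJ (giZ c hJ hu) hv; congr J.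
    rewrite mevalD mevalZ scalerDl scalerBr scalerA opprD !addrA; congr (_ - _).
    by rewrite addrAC.
  elim: e => [|e IHe] m hm.
    move/eqP: hm; rewrite mdeg_eq0 => /eqP ->.
    by rewrite mpolyX0 meval1 expr0 scale1r subrr; exact: gi0.
  have [i [m' [hm' ->]]] := mon_step k hm.
  have := giD hJ (giM 'X_i hJ (IHe _ hm')) (giM ('X_[m'].@[a] *: x ^+ e) hJ (ha i)).
  congr J; rewrite mulrBr mevalM mevalXU exprS -!mul_mpolyC mpolyCM.
  by ring.
(* If [a] were zero, all variables and hence [x] would lie in [J]. *)
have [i a0] : exists i, a i != 0.
  apply: NNPP => na; apply: nx; rewrite (homX_span hx).
  apply: subsp_sum => [|i _]; first exact: gi_subsp.
  apply: giZ => //; have := ha i; suff -> : a i = 0 by rewrite scale0r subr0.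
  by apply/eqP/negPn/negP => n; apply: na; exists i.
have [e [p [pe pJ pa]]] := nJ a (ex_intro _ i a0).
have xe : J (x ^+ e).
  have := giZ (p.@[a])^-1 hJ (giB hJ pJ (hp _ _ pe)).
  by rewrite opprB addrC subrK scalerA mulVf // scale1r.
apply: npJ; exists e => j u hj hu; apply: (gi_eqm hJ (hp _ _ hu)).
by apply: giZ => //; rewrite -(subnK hj) exprD; exact: giM.
Qed.

End Null.

(** * Forms and finite sets of points *)

Section Points.
Variables (N : nat).
Local Notation pt k := ('I_N -> k).

Lemma meval_scale (k : fieldType) e (c : k) (v w : pt k) : (forall i, w i = c * v i) ->
  forall p : {mpoly k[N]}, homd e p -> p.@[w] = c ^+ e * p.@[v].
Proof.
move=> hw; apply: (@homd_ind N k e (fun p => p.@[w] = c ^+ e * p.@[v])).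
  split; first by rewrite !meval0 mulr0.
  by move=> a p q hp hq; rewrite !mevalD !mevalZ hp hq; ring.
move=> m <-; rewrite !mevalX mdegE -prodrXr -big_split /=; apply: eq_bigr => i _.
by rewrite hw exprMn.
Qed.

Lemma proj_eq_sym (k : fieldType) (v w : pt k) : proj_eq v w -> proj_eq w v.
Proof.
move=> [c [c0 h]]; exists c^-1; split; first by rewrite invr_eq0.
by move=> i; rewrite h mulrA mulVf // mul1r.
Qed.

(** The 2 by 2 minors [w_a X_i - w_i X_a] vanish at [w]; if all of them vanished at [v], the two
    points would be proportional. *)
Lemma sep_points (k : fieldType) (v w : pt k) : ppoint v -> ppoint w -> ~ proj_eq w v ->
  exists l : {mpoly k[N]}, [/\ homd 1 l, l.@[w] = 0 & l.@[v] != 0].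
Proof.
move=> [b vb] [a wa] ne.
have hl i : homd 1 (w a *: 'X_i - w i *: 'X_a : {mpoly k[N]}).
  by apply: subspB; [exact: hom_subsp | apply: subspZ; [exact: hom_subsp | exact: hom_X] ..].
have ev i (z : pt k) : (w a *: 'X_i - w i *: 'X_a : {mpoly k[N]}).@[z] = w a * z i - w i * z a.
  by rewrite mevalB !mevalZ !mevalXU.
apply: NNPP => no.
have h i : v i = v a / w a * w i.
  have e0 : w a * v i - w i * v a = 0.
    apply/eqP/negPn/negP => n; apply: no.
    exists (w a *: 'X_i - w i *: 'X_a); split; rewrite ?ev //.
    by rewrite mulrC subrr.
  move/eqP: e0; rewrite subr_eq0 => /eqP e0; apply: (mulfI wa); rewrite e0.
  by field.
apply: ne; exists (v a / w a); split=> //.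
by rewrite mulf_neq0 ?invr_eq0 //; apply: contraNneq vb => va; rewrite h va !mul0r.
Qed.

Lemma interpolate (k : fieldType) r (p : 'I_r -> pt k) j :
  (forall i, ppoint (p i)) -> (forall i l, i != l -> ~ proj_eq (p i) (p l)) ->
  (r <= j.+1)%N ->
  forall i, exists q : {mpoly k[N]},
    [/\ homd j q, q.@[p i] != 0 & forall l, l != i -> q.@[p l] = 0].
Proof.
move=> hp ne hr i.
have hl l : exists q : {mpoly k[N]}, l != i -> [/\ homd 1 q, q.@[p l] = 0 & q.@[p i] != 0].
  case: (eqVneq l i) => [_|li]; first by exists 0.
  by have [q hq] := sep_points (hp i) (hp l) (ne _ _ li); exists q.
have [f hf] := fin_all_exists hl; have [a pa] := hp i.
(* Linear forms separating [p i] from each other point, filled up to degree [j] by a coordinate that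
   is nonzero at [p i]. *)
exists (\prod_(l | l != i) f l * 'X_a ^+ (j - r.-1)); split.
- have er : (\sum_(l | l != i) 1 = r.-1)%N.
    by rewrite sum1_card -[X in X = _]/#|predC (pred1 i)| cardC1 card_ord.
  have le : (r.-1 <= j)%N by lia.
  rewrite -[X in homd X](subnKC le); apply: homM; last by apply: hom_exp1; exact: hom_X.
  rewrite -er; apply: (big_ind2 (fun n q => homd n q)) => [|n1 q1 n2 q2|l /hf []] //.
    exact: hom_1.
  exact: homM.
- rewrite mevalM rmorph_prod rmorphXn /= mevalXU mulf_neq0 ?expf_neq0 //.
  by apply/prodf_neq0 => l /hf [].
- move=> l li; rewrite mevalM rmorph_prod /= (bigD1 l) //=.
  by have [_ -> _] := hf l li; rewrite !mul0r.
Qed.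

(* Evaluation at the points maps [P_j] onto [k^r] for [j] large, and [f] acts
   invertibly on [k^r]. *)
Lemma points_le (k : fieldType) (J : {mpoly k[N]} -> Prop) d f r (p : 'I_r -> pt k) B :
  gideal J -> homd d f -> (0 < d)%N ->
  (forall i, ppoint (p i)) -> (forall i l, i != l -> ~ proj_eq (p i) (p l)) ->
  (forall u, J u -> forall i, u.@[p i] = 0) -> (forall i, f.@[p i] != 0) ->
  (d <= B)%N -> (r <= B)%N -> (r <= \sum_(j < B) HF (adj J f) j)%N.
Proof.
move=> hJ hf d0 hp ne Jp fp dB rB.
pose Y (u : {mpoly k[N]}) := forall i, u.@[p i] = 0.
have sY : subsp Y.
  split=> [i|c u v hu hv i]; first by rewrite meval0.
  by rewrite mevalD mevalZ hu hv mulr0 addr0.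
have ha := adj_gideal hJ hf.
have low j : (j < d)%N -> (HF Y j <= HF (adj J f) j)%N.
  move=> lt; rewrite (HF_adj_lt hJ hf lt); apply: HF_mono_subsp => //; first exact: gi_subsp.
  by move=> u _ /Jp.
(* As [f] is nonzero at every point, it acts injectively modulo [Y]. Its image together with [Y]
   contains the degree [j + d] part of [J + (f)], which bounds the cokernel. *)
have step j : (HF Y (j + d) <= HF Y j + HF (adj J f) (j + d))%N.
  pose B'' (u : {mpoly k[N]}) := exists b, homd j b /\ Y (u - f * b).
  have sB : subsp B''.
    split; first by exists 0; rewrite mulr0 subrr; split; [case: (hom_subsp k N j) | case: sY].
    move=> c u v [b [hb1 hb2]] [b' [hb1' hb2']]; exists (c *: b + b'); split.
      by apply: (proj2 (hom_subsp k N j)).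
    have := (proj2 sY) c _ _ hb2 hb2'; congr Y.
    by rewrite mulrDr -scalerAr scalerBr opprD !addrA; congr (_ - _); rewrite addrAC.
  have [s hs] : exists s, qdim (homd (j + d)) B'' s by apply: (HFP0 (j := j + d)).
  have -> : HF Y (j + d) = (HF Y j + s)%N.
    apply: (qdim_uniq sY (HFPs _ sY)).
    apply: (qdim_exact (V := {mpoly k[N]}) (W := {mpoly k[N]}) (f := mulby f)
      _ _ _ _ _ _ _ _ _ _ (HFPs j sY) hs) => //;
      rewrite /= /mulby; try exact: hom_subsp.
    - by move=> u hu; rewrite addnC; exact: homM.
    - by move=> u hu i; rewrite mevalM hu mulr0.
    - move=> u _ hu i; have /eqP := hu i; rewrite mevalM mulf_eq0 (negbTE (fp i)).
      by move/eqP.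
    - by move=> u hu; exists 0; rewrite mulr0 subr0; split=> //; case: (hom_subsp k N j).
    - by move=> u hu; exists u; rewrite subrr; split=> //; case: sY.
    - by move=> u _ [b [h1 h2]]; exists b.
  rewrite leq_add2l; have [e [eA _ es]] := HFP (j + d) ha.
  apply: (qdim_le sB hs); exists e => u hu; have [c hc] := es _ hu; exists c.
  have hv : homd (j + d) (u - \sum_i c i *: e i).
    apply: subspB => //; first exact: hom_subsp.
    by apply: subsp_sum => [|i _]; [exact: hom_subsp | apply: subspZ => //; exact: hom_subsp].
  have [b [hb _ hJb]] := adj_hom hJ hf hv hc; rewrite addnK in hb.
  by exists b; split=> //; rewrite mulrC; exact: Jp.
(* Summing [step] leaves the last values of [HF Y]; the very last one, at [B - 1], is at least [r]
   by interpolation. *)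
have tele C : (\sum_(j < C) HF Y j <= \sum_(j < C) HF (adj J f) j + \sum_(j < C - d) HF Y j)%N.
  elim: C => [|C IH]; first by rewrite !big_ord0.
  rewrite !big_ord_recr /=; case: (ltnP C d) => hC.
    have -> : (C.+1 - d = 0)%N by lia.
    have e0 : (C - d = 0)%N by lia.
    by move: IH; rewrite e0 !big_ord0 !addn0 => IH; apply: leq_add => //; exact: low.
  rewrite subSn // big_ord_recr /=.
  have h := step (C - d)%N; rewrite subnK // in h.
  by rewrite addnACA; apply: leq_add => //; rewrite addnC.
have top : (r <= HF Y B.-1)%N.
  have hr : (r <= B.-1.+1)%N by lia.
  have [q hq] := fin_all_exists (interpolate hp ne hr).
  apply: (qdim_ge sY (HFPs _ sY)); exists q; split; first by move=> i; case: (hq i).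
  move=> c hc i; have := hc i; rewrite raddf_sum /= (bigD1 i) //= big1.
    rewrite addr0 mevalZ => /eqP; rewrite mulf_eq0; have [_ /negbTE -> _] := hq i.
    by rewrite orbF => /eqP.
  move=> l li; rewrite mevalZ; have [_ _ h] := hq l.
  by rewrite h ?mulr0 // eq_sym.
have t := tele B.
have e : (\sum_(j < B) HF Y j = \sum_(j < B.-1) HF Y j + HF Y B.-1)%N.
  by have -> : B = (B.-1).+1 by [lia]; rewrite big_ord_recr.
have le : (\sum_(j < B - d) HF Y j <= \sum_(j < B.-1) HF Y j)%N.
  have -> : B.-1 = (B - d + (B.-1 - (B - d)))%N by lia.
  by rewrite big_split_ord leq_addr.
apply: leq_trans top _; move: t; rewrite e addnC => t.
by have := leq_trans t (leq_add (leqnn _) le); rewrite leq_add2r.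
Qed.

(** By [points_le] the number of distinct zeros of [J] is at most the length of [P / (J, f)]. A
    family of distinct zeros can thus be enlarged only finitely often. *)
Lemma zeros_cover (k : fieldType) (J : {mpoly k[N]} -> Prop) d f : gideal J -> homd d f ->
  (0 < d)%N -> mprim (adj J f) ->
  exists r (p : 'I_r -> pt k), [/\ forall i, ppoint (p i),
    forall i u, J u -> u.@[p i] = 0
    & forall v, ppoint v -> (forall u, J u -> u.@[v] = 0) -> exists i, proj_eq (p i) v].
Proof.
move=> hJ hf d0 hm; have ha := adj_gideal hJ hf.
have fv v : ppoint v -> (forall u, J u -> u.@[v] = 0) -> f.@[v] != 0.
  move=> [i vi] hv; apply/negP => /eqP f0; have [M hM] := hm.
  have [b hb] := hM M ('X_i ^+ M) (leqnn M) (hom_exp1 M (hom_X k i)).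
  have := hv _ hb; rewrite mevalB mevalM f0 mulr0 subr0 rmorphXn /= mevalXU => /eqP.
  by rewrite expf_eq0 (negbTE vi) andbF.
have [M hM] := mprimP ha hm; pose L := (\sum_(j < M) HF (adj J f) j)%N.
have bound r (p : 'I_r -> pt k) : (forall i, ppoint (p i)) ->
    (forall i u, J u -> u.@[p i] = 0) ->
    (forall i l, i != l -> ~ proj_eq (p i) (p l)) -> (r <= L)%N.
  (* The summation bound [M + (d + r)] is at least [d] and [r], and the terms from [M] on vanish. *)
  move=> hp Jp ne; have := @points_le k J d f r p (M + (d + r)) hJ hf d0 hp ne.
  move=> /(_ (fun u hu i => Jp i u hu) (fun i => fv _ (hp i) (Jp i))).
  move=> /(_ ltac:(lia) ltac:(lia)) h; apply: leq_trans h _.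
  rewrite big_split_ord /= [X in (_ + X)%N]big1 ?addn0 // => i _.
  by apply: hM; rewrite leq_addr.
suff H m : forall r (p : 'I_r -> pt k), (L < r + m)%N -> (forall i, ppoint (p i)) ->
    (forall i u, J u -> u.@[p i] = 0) ->
    (forall i l, i != l -> ~ proj_eq (p i) (p l)) ->
    exists r (p : 'I_r -> pt k), [/\ forall i, ppoint (p i),
    forall i u, J u -> u.@[p i] = 0
    & forall v, ppoint v -> (forall u, J u -> u.@[v] = 0) -> exists i, proj_eq (p i) v].
  by apply: (H L.+1 0%N (fun _ _ => 0)) => //; case.
elim: m => [|m IHm] r p lt hp Jp ne.
  by have := bound _ _ hp Jp ne; rewrite leqNgt -(addn0 r) lt.
case: (classic (forall v, ppoint v -> (forall u, J u -> u.@[v] = 0) ->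
         exists i, proj_eq (p i) v)); first by move=> h; exists r, p.
move=> /not_all_ex_not [v hv].
have [pv hv'] := imply_to_and _ _ hv; have [Jv nv] := imply_to_and _ _ hv'.
pose p' (i : 'I_r.+1) := if unlift ord0 i is Some j then p j else v.
apply: (IHm _ p'); first by rewrite addSnnS.
- by move=> i; rewrite /p'; case: unliftP.
- by move=> i u Ju; rewrite /p'; case: unliftP => [j _|_]; [exact: Jp | exact: Jv].
- move=> i l; rewrite /p'; case: unliftP => [i' ->|->]; case: unliftP => [l' ->|->] //.
  + by rewrite (inj_eq lift_inj); exact: ne.
  + by move=> _ h; apply: nv; exists i'.
  + by move=> _ /proj_eq_sym h; apply: nv; exists l'.
Qed.

(** The value at [p i] is a polynomial in [x], nonzero because some coefficient [h(p i)] is; an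
    algebraically closed field has a non-root of the product over [i]. *)
Lemma avoid (k : closedFieldType) r (p : 'I_r -> pt k) (hs : seq {mpoly k[N]}) :
  (forall i, exists2 h, h \in hs & h.@[p i] != 0) ->
  exists x : k, forall i, (\sum_(j < size hs) x ^+ j *: hs`_j).@[p i] != 0.
Proof.
move=> hh; pose q i := \poly_(j < size hs) (hs`_j).@[p i].
have q0 : \prod_i q i != 0.
  apply/prodf_neq0 => i _; have [h hin hi] := hh i.
  apply: contraNneq hi => e; have := congr1 (fun q : {poly k} => q`_(index h hs)) e.
  by rewrite coef_poly index_mem hin nth_index // coef0 => ->.
have /closed_nonrootP [x] := q0; rewrite /root horner_prod => /prodf_neq0 hx.
exists x => i; have := hx i isT; rewrite horner_poly raddf_sum /=; congr (_ != _).
by apply: eq_bigr => j _; rewrite mevalZ mulrC.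
Qed.

Lemma gi_component (k : fieldType) (J : {mpoly k[N]} -> Prop) u v : gideal J -> J u ->
  u.@[v] != 0 -> exists e p, [/\ homd e p, J p & p.@[v] != 0].
Proof.
move=> hJ Ju uv; apply: NNPP => no.
move/negP: uv; apply; rewrite (pihomog_partitionE (leqnn (mmeasure mdeg u))) raddf_sum /=.
apply/eqP/big1 => e _; apply/eqP/negPn/negP => n; apply: no.
by exists e, (pihomog mdeg e u); split=> //; [exact: pihomogP | exact: giH].
Qed.

(** Every common zero of [J] is proportional to some [p i], where [g] is nonzero, so [J + (g)] has
    no projective zero and the Nullstellensatz applies. *)
Lemma mprim_avoid (k : closedFieldType) (J : {mpoly k[N]} -> Prop) r (p : 'I_r -> pt k) e g :
  gideal J -> homd e g ->
  (forall v, ppoint v -> (forall u, J u -> u.@[v] = 0) -> exists i, proj_eq (p i) v) ->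
  (forall i, g.@[p i] != 0) -> mprim (adj J g).
Proof.
move=> hJ hg hc gp; apply: nullstellensatz; first exact: adj_gideal hJ hg.
move=> v pv; case: (classic (forall u, J u -> u.@[v] = 0)) => [Jv|].
  have [i [c [c0 hv]]] := hc v pv Jv; exists e, g; split=> //; first exact: adj_self.
  by rewrite (meval_scale hv hg) mulf_neq0 ?expf_neq0.
move=> /not_all_ex_not [u hu]; have [Ju nu] := imply_to_and _ _ hu.
have [|e' [q [h1 h2 h3]]] := @gi_component k J u v hJ Ju; first exact/eqP.
by exists e', q; split=> //; exact: sub_adj.
Qed.

Lemma linear_avoid (k : closedFieldType) r (p : 'I_r -> pt k) : (forall i, ppoint (p i)) ->
  exists2 l : {mpoly k[N]}, homd 1 l & forall i, l.@[p i] != 0.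
Proof.
move=> hp; have [|x hx] := @avoid k r p [seq 'X_a | a <- enum 'I_N].
  move=> i; have [a pa] := hp i; exists 'X_a; last by rewrite mevalXU.
  by apply: map_f; rewrite mem_enum.
exists (\sum_(j < size [seq 'X_a : {mpoly k[N]} | a <- enum 'I_N])
  x ^+ j *: [seq 'X_a | a <- enum 'I_N]`_j) => //.
apply: subsp_sum => [|j _]; first exact: hom_subsp.
apply: subspZ; first exact: hom_subsp.
by have /mapP [a _ ->] := mem_nth 0 (ltn_ord j); exact: hom_X.
Qed.

Lemma choose_linear (k : closedFieldType) (J : {mpoly k[N]} -> Prop) d f : gideal J ->
  homd d f -> (0 < d)%N -> mprim (adj J f) ->
  exists2 l, homd 1 l & mprim (adj J l).
Proof.
move=> hJ hf d0 hm; have [r [p [hp _ hc]]] := zeros_cover hJ hf d0 hm.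
have [l hl lp] := linear_avoid hp; exists l => //.
exact: mprim_avoid hl hc lp.
Qed.

End Points.

(** * Complete intersections *)

Section CI.
Variables (k : closedFieldType) (N : nat).
Local Notation P := {mpoly k[N]}.
Implicit Types (J : P -> Prop) (s : seq (nat * P)) (x : nat * P).

Definition nzd J (a : P) : Prop := forall j u, homd j u -> J (a * u) -> J u.
Definition posform x : bool := (0 < x.1)%N && (x.2 \is x.1.-homog).
Definition idl J s : P -> Prop := foldl (fun J x => adj J x.2) J s.
Fixpoint regs J s : Prop :=
  if s is x :: s' then nzd J x.2 /\ regs (adj J x.2) s' else True.
Definition zeroid : P -> Prop := fun u => u = 0.
(** Together with [mprim J] this makes [P / J] Artinian Gorenstein of socle degree [sg]: every
    homogeneous socle element lies in degree [sg], and that degree is one-dimensional. *)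
Definition soc J sg : Prop :=
  (forall j u, homd j u -> (forall i, J ('X_i * u)) -> ~ J u -> j = sg) /\ HF J sg = 1%N.

Lemma zeroid_gideal : gideal zeroid.
Proof.
split=> //; rewrite /zeroid.
- by move=> u v -> ->; rewrite addr0.
- by move=> a u ->; rewrite mulr0.
- by move=> j u ->; rewrite raddf0.
Qed.

Lemma idl_gideal J s : gideal J -> all posform s -> gideal (idl J s).
Proof.
elim: s J => //= x s IH J hJ /andP [/andP [_ hx] hs].
by apply: IH => //; exact: adj_gideal hJ hx.
Qed.

Lemma idl_cat J s1 s2 : idl J (s1 ++ s2) = idl (idl J s1) s2.
Proof. by rewrite /idl foldl_cat. Qed.

Lemma idl_rcons J s x : idl J (rcons s x) = adj (idl J s) x.2.
Proof. by rewrite -cats1 idl_cat. Qed.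

Lemma idl_adj J s a : idl (adj J a) s = adj (idl J s) a.
Proof. by elim: s J => //= x s IH J; rewrite adjC IH. Qed.

Lemma sub_idl J s u : gideal J -> all posform s -> J u -> idl J s u.
Proof.
elim: s J => //= x s IH J hJ /andP [/andP [_ hx] hs] Ju.
by apply: IH => //; [exact: adj_gideal hJ hx | exact: sub_adj].
Qed.

Lemma mem_idl J s x : gideal J -> all posform s -> x \in s -> idl J s x.2.
Proof.
elim: s J => //= y s IH J hJ /andP [/andP [_ hy] hs].
have ha := adj_gideal hJ hy; rewrite inE => /orP [/eqP ->|]; last exact: IH.
by apply: sub_idl => //; exact: adj_self.
Qed.

Lemma idl_min J J' s : gideal J' -> (forall u, J u -> J' u) ->
  (forall x, x \in s -> J' x.2) -> forall u, idl J s u -> J' u.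
Proof.
move=> hJ'; elim: s J => //= x s IH J sJ hs.
apply: IH => [u|y ys]; last by apply: hs; rewrite inE ys orbT.
by apply: adj_min => //; apply: hs; rewrite mem_head.
Qed.

Lemma regs_cat J s1 s2 : regs J (s1 ++ s2) <-> regs J s1 /\ regs (idl J s1) s2.
Proof. by elim: s1 J => [|x s IH] J /=; [tauto | rewrite IH; tauto]. Qed.

(** A regular pair of forms can be permuted. If [b u] is in [J], then [u = v a] modulo [J] with
    [b v] in [J] again, and [v] has smaller degree because [0 < da]. *)
Lemma nzd_swap J da db a b : gideal J -> homd da a -> (0 < da)%N -> homd db b ->
  nzd J a -> nzd (adj J a) b -> nzd J b /\ nzd (adj J b) a.
Proof.
move=> hJ ha da0 hb na nb; have hAa := adj_gideal hJ ha; split.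
  move=> j; elim/ltn_ind: j => j IH u hu Jbu.
  have [v [hv v0 Jv]] := adj_hom hJ ha hu (nb _ _ hu (sub_adj a hJ Jbu)).
  case: (ltnP j da) => lt; first by move: Jv; rewrite v0 // mul0r subr0.
  apply: (gi_eqm hJ Jv); apply: giMr => //; apply: (IH (j - da)%N); [lia|by []|].
  apply: (na _ _ (homM hb hv)).
  have := giB hJ Jbu (giM b hJ Jv); congr J.
  by rewrite mulrBr opprB addrC subrK; ring.
(* From [a u = v b] follows [v = w a] modulo [J], and cancelling [a] gives [u = w b]. *)
move=> j u hu hau.
have [v [hv v0 Jv]] := adj_hom hJ hb (homM ha hu) hau.
case: (ltnP (da + j) db) => lt.
  by apply: sub_adj => //; apply: (na _ _ hu); move: Jv; rewrite v0 // mul0r subr0.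
have hbv : adj J a (b * v).
  by exists u; have := giN hJ Jv; congr J; rewrite opprB; congr (_ - _); ring.
have [w [hw w0 Jw]] := adj_hom hJ ha hv (nb _ _ hv hbv).
exists w; apply: (na j).
  case: (ltnP (da + j - db) da) => lt2; first by rewrite w0 // mul0r subr0.
  apply: subspB => //; first exact: hom_subsp.
  have -> : j = (da + j - db - da + db)%N by lia.
  exact: homM.
have := giD hJ Jv (giMr b hJ Jw); congr J; by ring.
Qed.

Lemma regs_move J x s : gideal J -> posform x -> all posform s -> nzd J x.2 ->
  regs (adj J x.2) s -> regs J s /\ nzd (idl J s) x.2.
Proof.
elim: s J => //= y s IH J hJ /andP [x0 hx] /andP [/andP [y0 hy] hs] nx [ny rs].
have [n1 n2] := nzd_swap hJ hx x0 hy nx ny.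
have [|||||h1 h2] := IH (adj J y.2) => //.
- exact: adj_gideal hJ hy.
- by rewrite /posform x0.
- by rewrite adjC.
Qed.

Lemma nzd_HF J d a j : gideal J -> homd d a -> nzd J a -> HF (colon J a) j = HF J j.
Proof.
move=> hJ ha na; have hc := colon_gideal hJ ha.
by apply/eqP; rewrite eqn_leq !HF_mono // => u; [exact: na | move=> _; exact: sub_colon].
Qed.

Lemma HF0_le J : gideal J -> (HF J 0 <= 1)%N.
Proof.
move=> hJ; apply: (qdim_le (gi_subsp hJ) (HFP 0 hJ)); exists (fun=> 1) => u /hom0C [c ->].
exists (fun=> c); rewrite big_ord1 -mul_mpolyC mulr1 subrr; exact: gi0.
Qed.

Lemma HF0_eq1 J : gideal J -> ~ J 1 -> HF J 0 = 1%N.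
Proof.
move=> hJ n1; have := HF0_le hJ; case e: (HF J 0) => [|[]] // _.
by case: n1; apply: (HF_eq0 hJ e); exact: hom_1.
Qed.

Lemma sub_morph J (h : {rmorphism P -> P}) : gideal J ->
  (forall c : k, h c%:MP = c%:MP) ->
  (forall i, J ('X_i - h 'X_i)) -> forall u, J (u - h u).
Proof.
move=> hJ hc hX.
have hm j (m : 'X_{1..N}) : mdeg m = j -> J ('X_[m] - h 'X_[m]).
  elim: j m => [|j IH] m hm.
    move/eqP: hm; rewrite mdeg_eq0 => /eqP ->.
    by rewrite mpolyX0 rmorph1 subrr; exact: gi0.
  have [i [m' [hm' ->]]] := mon_step k hm.
  have := giD hJ (giM 'X_i hJ (IH _ hm')) (giM (h 'X_[m']) hJ (hX i)).
  by congr J; rewrite rmorphM; ring.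
move=> u; rewrite [u]mpolyE raddf_sum /= -sumrB; apply: subsp_sum; first exact: gi_subsp.
move=> m _; rewrite -mul_mpolyC rmorphM hc /= -mulrBr; apply: giM => //; exact: hm.
Qed.

(* In particular such an ideal is prime. *)
Lemma linear_ker s : all (fun x => posform x && (x.1 == 1%N)) s ->
  exists h : {rmorphism P -> P}, [/\ forall c : k, h c%:MP = c%:MP,
    forall i, homd 1 (h 'X_i), forall u, idl zeroid s u <-> h u = 0
    & forall u, idl zeroid s (u - h u)].
Proof.
elim/last_ind: s => [_|s x IH].
  exists idfun; split=> //= [i|u]; [exact: hom_X | by rewrite subrr].
rewrite all_rcons => /andP [/andP [/andP [_ hx] /eqP x1] hs].
rewrite x1 in hx; have [h [hC hX hK hS]] := IH hs.
have hJ : gideal (idl zeroid s).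
  apply: idl_gideal; first exact: zeroid_gideal.
  by apply: sub_all hs => y /andP [].
rewrite idl_rcons; have hA := adj_gideal hJ hx.
have h1 : forall u, homd 1 u -> homd 1 (h u).
  move=> u /homX_span ->; rewrite raddf_sum /=.
  apply: subsp_sum => [|i _]; first exact: hom_subsp.
  by rewrite -mul_mpolyC rmorphM hC /= mul_mpolyC; apply: subspZ => //; exact: hom_subsp.
case: (eqVneq (h x.2) 0) => [h0|nz].
  exists h; split=> //.
    move=> u; split=> [[b /hK]|/hK]; last exact: sub_adj.
    by rewrite rmorphB rmorphM /= h0 mulr0 subr0.
  by move=> u; apply: sub_adj.
set l := h x.2 in nz; have hl : homd 1 l by exact: h1.
have [a la] : exists a, l@_U_(a) != 0.
  apply: NNPP => no; move/negP: nz; apply; apply/eqP; rewrite (homX_span hl).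
  apply: big1 => i _; apply/eqP; rewrite scaler_eq0; apply/orP; left.
  by apply/negPn/negP => n; apply: no; exists i.
(* [T] changes only [X_a], from which it subtracts [l] divided by its coefficient at [X_a]; hence
   [T l = l - l = 0]. *)
pose th (i : 'I_N) : P := 'X_i - ((i == a)%:R / l@_U_(a)) *: l.
pose T : {rmorphism P -> P} := comp_mpoly [tuple th i | i < N].
have TX i : T 'X_i = th i by rewrite /T /= comp_mpolyXU -tnth_nth tnth_mktuple.
have TC c : T c%:MP = c%:MP by rewrite /T /= comp_mpolyC.
have Tl : T l = 0.
  rewrite {1}(homX_span hl) raddf_sum /=.
  under eq_bigr do rewrite -mul_mpolyC rmorphM TC TX mul_mpolyC /th scalerBr scalerA.
  rewrite sumrB -homX_span // (bigD1 a) //= big1 ?addr0.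
    by rewrite eqxx mulrA mulr1 mulfV // scale1r subrr.
  by move=> i /negbTE ->; rewrite mul0r mulr0 scale0r.
have Al : adj (idl zeroid s) x.2 l.
  exists 1; rewrite mul1r; have := giN hJ (hS x.2); congr (idl _ _ _).
  by rewrite opprB.
have AT : forall u, adj (idl zeroid s) x.2 (u - T u).
  apply: sub_morph => // i; rewrite TX /th opprB addrC subrK.
  exact: giZ.
have AS u : adj (idl zeroid s) x.2 (u - T (h u)).
  have := giD hA (sub_adj x.2 hJ (hS u)) (AT (h u)); congr adj.
  by rewrite addrA subrK.
exists (GRing.RMorphism.clone _ _ (T \o h) _); split=> /=.
- by move=> c; rewrite hC TC.
- move=> i; rewrite /= (homX_span (hX i)) raddf_sum /=.
  apply: subsp_sum => [|b _]; first exact: hom_subsp.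
  rewrite /= -mul_mpolyC rmorphM TC TX mul_mpolyC; apply: subspZ; first exact: hom_subsp.
  apply: subspB; [exact: hom_subsp | exact: hom_X |].
  by apply: subspZ => //; exact: hom_subsp.
- move=> u; split=> [[b /hK]|h0].
    rewrite rmorphB rmorphM /= -/l => /eqP; rewrite subr_eq0 => /eqP ->.
    by rewrite rmorphM /= Tl mulr0.
  by have := AS u; rewrite [T (h u)]h0 subr0.
- exact: AS.
Qed.

Lemma HF_zeroid1 : (N <= HF zeroid 1)%N.
Proof.
have hz := zeroid_gideal.
apply: (qdim_ge (gi_subsp hz) (HFP 1 hz)); exists (fun i => 'X_i); split=> [i|c hc i].
  exact: hom_X.
have := congr1 (fun u : P => u@_U_(i)) hc; rewrite mcoeff0 raddf_sum /= (bigD1 i) //=.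
rewrite mcoeffZ mcoeffXU eqxx mulr1 big1 ?addr0 // => l li.
by rewrite mcoeffZ mcoeffXU (negbTE li) mulr0.
Qed.

(** Each linear form lowers [HF] in degree 1 by at most one. If all do, each lies outside the ideal
    of the previous ones, which is prime by [linear_ker], so it is a nonzerodivisor. *)
Lemma linear_regs s : all (fun x => posform x && (x.1 == 1%N)) s ->
  (N <= HF (idl zeroid s) 1 + size s)%N /\
  (N = (HF (idl zeroid s) 1 + size s)%N -> regs zeroid s).
Proof.
elim/last_ind: s => [_|s x IH]; first by rewrite addn0; split=> //; exact: HF_zeroid1.
rewrite all_rcons => /andP [/andP [/andP [x0 hx] /eqP x1] hs].
have [le rg] := IH hs; rewrite idl_rcons size_rcons.
have hJ : gideal (idl zeroid s).
  apply: idl_gideal; first exact: zeroid_gideal.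
  by apply: sub_all hs => y /andP [].
have ex := HF_exact 0 hJ hx; rewrite x1 add0n in ex.
have c1 := HF0_le (colon_gideal hJ hx).
split; first by lia.
move=> e; rewrite -cats1; apply/regs_cat; split; first by apply: rg; lia.
split=> // j u _ hxu; have [h [_ _ hK _]] := linear_ker hs.
have nx : ~ idl zeroid s x.2.
  move=> hxs; suff : HF (colon (idl zeroid s) x.2) 0 = 0%N by lia.
  apply: HF_0 => [|v _]; [exact: colon_gideal hJ hx | by apply: giMr].
move/hK: hxu; rewrite rmorphM => /eqP; rewrite mulf_eq0 => /orP [] /eqP /hK //.
Qed.

(* [P_j/J_j] has constant dimension for [j] large and [f] acts surjectively there,
   hence injectively; powers of [l] bring every degree into that range. *)
Lemma nzd_dim J d f l : gideal J -> homd 1 l -> nzd J l -> mprim (adj J l) ->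
  homd d f -> mprim (adj J f) -> nzd J f.
Proof.
move=> hJ hl nl /(mprimP (adj_gideal hJ hl)) [M1 h1] hf /(mprimP (adj_gideal hJ hf)) [M2 h2].
have e1 j : (M1 <= j)%N -> HF J j.+1 = HF J j.
  by move=> hj; rewrite -addn1 (HF_exact j hJ hl) h1 ?addn0 ?(nzd_HF _ hJ hl) // addn1 leqW.
have e2 j i : (M1 <= j)%N -> HF J (j + i) = HF J j.
  by move=> hj; elim: i => [|i IH]; rewrite ?addn0 // addnS e1 // (leq_trans hj) ?leq_addr.
have big j u : (M1 + M2 <= j)%N -> homd j u -> J (f * u) -> J u.
  move=> hj; apply: (HF_mono_eq hJ (colon_gideal hJ hf)) => [v|]; first exact: sub_colon.
  have := HF_exact j hJ hf; rewrite h2 ?addn0 => [<-|]; last by lia.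
  by apply: e2; lia.
move=> j u hu Jfu; have : J (l ^+ (M1 + M2) * u).
  apply: (big (M1 + M2 + j)%N); first by lia.
    by apply: homM => //; exact: hom_exp1.
  by rewrite mulrCA; exact: giM.
elim: (M1 + M2)%N => [|i IH]; first by rewrite expr0 mul1r.
rewrite exprS -mulrA => /(nl (i + j)%N) h; apply: IH; apply: h.
by apply: homM => //; exact: hom_exp1.
Qed.

(** Multiply [u] by variables as long as the product stays outside [J]. Since [J] contains all forms
    of large degree, this stops, at a socle element, which has degree [sg]. *)
Lemma soc_pair J sg : gideal J -> mprim J -> soc J sg -> forall j u, homd j u -> ~ J u ->
  (j <= sg)%N /\ exists v, homd (sg - j) v /\ ~ J (u * v).
Proof.
move=> hJ [M hM] [hs _] j u.
have [m] := ubnP (M - j)%N; elim: m j u => // m IH j u hm hu nu.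
case: (classic (forall i, J ('X_i * u))) => [h|/not_all_ex_not [i ni]].
  have e := hs _ _ hu h nu; rewrite e; split=> //; exists 1.
  by rewrite subnn mulr1; split=> //; exact: hom_1.
have hXu : homd j.+1 ('X_i * u) by rewrite -add1n; apply: homM => //; exact: hom_X.
have lt : (j < M)%N.
  by rewrite ltnNge; apply/negP => le; apply: nu; exact: (hM j).
have [|le [v [hv nv]]] := IH _ _ _ hXu ni; first by lia.
split; first exact: ltnW.
exists ('X_i * v); split; last by rewrite mulrCA mulrA.
have -> : (sg - j = 1 + (sg - j.+1))%N by lia.
by apply: homM => //; exact: hom_X.
Qed.

Lemma HF_sum J d f B : gideal J -> homd d f -> nzd J f ->
  (\sum_(j < B) HF (adj J f) j + \sum_(j < B - d) HF J j = \sum_(j < B) HF J j)%N.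
Proof.
move=> hJ hf nf; elim: B => [|B IH]; first by rewrite !big_ord0.
rewrite big_ord_recr [RHS]big_ord_recr /= -IH; case: (ltnP B d) => hB.
  have -> : (B.+1 - d = 0)%N by lia.
  have -> : (B - d = 0)%N by lia.
  by rewrite big_ord0 !addn0 (HF_adj_lt hJ hf).
rewrite subSn // big_ord_recr /=; have := HF_exact (B - d) hJ hf.
by rewrite subnK // (nzd_HF _ hJ hf) // => ->; rewrite addnACA; congr addn; rewrite addnC.
Qed.

(* The socles modulo [f] and modulo [l] correspond by [u |-> w] when [l u = f w]
   modulo [J]. *)
Lemma soc_exchange J d f l sg : gideal J -> homd 1 l -> nzd J l -> mprim (adj J l) ->
  (0 < d)%N -> homd d f -> nzd J f -> soc (adj J l) sg -> soc (adj J f) (sg + (d - 1)).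
Proof.
move=> hJ hl nl ml d0 hf nf hs; have hAl := adj_gideal hJ hl; have hAf := adj_gideal hJ hf.
have top j : (sg < j)%N -> HF (adj J l) j = 0%N.
  move=> lt; apply: HF_0 => // u hu; apply: NNPP => nu.
  by have [] := soc_pair hAl ml hs hu nu; rewrite leqNgt lt.
have rec j : HF J j.+1 = (HF J j + HF (adj J l) j.+1)%N.
  by rewrite -addn1 (HF_exact j hJ hl) (nzd_HF _ hJ hl).
have const i : HF J (sg + i) = HF J sg.
  by elim: i => [|i IH]; rewrite ?addn0 // addnS rec IH top ?addn0 // -addSn ltn_addr.
case: hs => hs h1; split; last first.
  (* [HF J] is constant from [sg] on, so [HF (adj J f)] at [sg + d - 1] is the last jump of [HF J],
     namely [HF (adj J l) sg = 1]; for [sg = 0] the jump is [HF J 0]. *)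
  case: sg hs h1 top const => [|sg] hs h1 top const.
    rewrite add0n (HF_adj_lt hJ hf); last by lia.
    by have := const (d - 1)%N; rewrite add0n => ->; rewrite -h1 (HF_adj_lt hJ hl).
  have -> : (sg.+1 + (d - 1) = sg + d)%N by lia.
  have := HF_exact sg hJ hf; rewrite (nzd_HF _ hJ hf) //.
  have -> : (sg + d = sg.+1 + (d - 1))%N by lia.
  by rewrite const rec h1 => /addnI.
move=> j u hu hX nu.
have [w [hw w0 Jw]] : exists w,
    [/\ homd (j.+1 - d) w, (j.+1 < d)%N -> w = 0 & J (l * u - w * f)].
  apply: (adj_hom hJ hf); first by rewrite -add1n; exact: homM.
  rewrite (homX_span hl) mulr_suml; apply: subsp_sum => [|i _]; first exact: gi_subsp.
  by rewrite -scalerAl; apply: giZ.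
have nw : ~ adj J l w.
  move=> aw; apply: nu; have [b [hb b0 Jb]] := adj_hom hJ hl hw aw.
  exists b; apply: (nl j).
    apply: subspB => //; first exact: hom_subsp.
    case: (ltnP j d) => lt; first by rewrite b0 ?mul0r; [case: (hom_subsp k N j) | lia].
    have -> : j = (j.+1 - d - 1 + d)%N by lia.
    exact: homM.
  have := giD hJ Jw (giMr f hJ Jb); congr J; by ring.
have le : (d <= j.+1)%N.
  rewrite leqNgt; apply/negP => lt; apply: nw; rewrite w0 //.
  exact: gi0.
(* The cofactor [w] is a socle element modulo [l], so its degree is [sg]. *)
suff : (j.+1 - d)%N = sg by lia.
apply: (hs _ w) => // i.
have hXu : homd j.+1 ('X_i * u) by rewrite -add1n; apply: homM => //; exact: hom_X.
have [v [hv _ Jv]] := adj_hom hJ hf hXu (hX i).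
exists v; apply: (nf (1 + (j.+1 - d))%N).
  apply: subspB; [exact: hom_subsp | by apply: homM => //; exact: hom_X |].
  by rewrite mulrC; exact: homM.
have := giB hJ (giM l hJ Jv) (giM 'X_i hJ Jw); congr J; by ring.
Qed.

(* Induction on the number of nonlinear forms: the last one is exchanged for a
   linear form. *)
Lemma ci_theorem t : forall fs L, size fs = t -> (size L + t = N)%N ->
  all (fun x => posform x && (x.1 == 1%N)) L -> all posform fs ->
  mprim (idl zeroid (L ++ fs)) ->
  [/\ regs zeroid (L ++ fs),
      forall B, (\sum_(j < B) HF (idl zeroid (L ++ fs)) j <= \prod_(x <- fs) x.1)%N
    & soc (idl zeroid (L ++ fs)) (\sum_(x <- fs) (x.1 - 1))].
Proof.
have hz := zeroid_gideal.
have lin L : all (fun x => posform x && (x.1 == 1%N)) L -> all posform L.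
  by move=> hL; apply: sub_all hL => y /andP [].
elim: t => [|t IH] fs L.
  move=> /size0nil ->; rewrite addn0 cats0 !big_nil => sL hL _ [M hM].
  have hJ := idl_gideal hz (lin _ hL).
  have [h [_ _ hK _]] := linear_ker hL.
  (* The ideal is prime and contains a power of every variable. *)
  have JX i : idl zeroid L 'X_i.
    have /hK := hM M ('X_i ^+ M) (leqnn M) (hom_exp1 M (hom_X k i)).
    by rewrite rmorphXn /= => /eqP; rewrite expf_eq0 => /andP [_ /eqP /hK].
  have n1 : ~ idl zeroid L 1 by move=> /hK; rewrite rmorph1 => /eqP; rewrite oner_eq0.
  have Hj j : HF (idl zeroid L) j.+1 = 0%N.
    by apply: HF_0 => // u; exact: gen_all.
  split.
  - by apply: (proj2 (linear_regs hL)); rewrite Hj.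
  - case=> [|B]; first by rewrite big_ord0.
    rewrite big_ord_recl big1 ?addn0; first exact: HF0_le.
    by move=> i _; exact: Hj.
  - split; last exact: HF0_eq1.
    by move=> [|j] u hu _ nu //; case: nu; exact: gen_all hu.
case/lastP: fs => // fs [d f]; rewrite size_rcons => -[sfs] sL hL.
rewrite all_rcons => /andP [/andP [/= d0 hf] hfs].
rewrite -rcons_cat idl_rcons /=; set J := idl zeroid (L ++ fs) => mf.
have hLfs : all posform (L ++ fs) by rewrite all_cat lin.
have hJ : gideal J by exact: idl_gideal.
have [l hl ml] := choose_linear hJ hf d0 mf.
have eJl : idl zeroid (rcons L (1%N, l) ++ fs) = adj J l.
  by rewrite /J idl_cat idl_rcons idl_adj -idl_cat.
have [||||rg sm sc] := IH fs (rcons L (1%N, l)) sfs.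
- by rewrite size_rcons addSnnS.
- by rewrite all_rcons hL /posform /= !andbT; exact: hl.
- by [].
- by rewrite eJl.
rewrite eJl in sm sc.
(* The regular sequence [L, l, fs] stays regular when [l] is moved to its end. *)
have [rL nl] : regs zeroid (L ++ fs) /\ nzd J l.
  move: rg; rewrite -cats1 -catA => /regs_cat [rL /= [nl rfs]].
  have [r1 r2] := regs_move (x := (1%N, l)) (idl_gideal hz (lin _ hL)) hl hfs nl rfs.
  by split; [apply/regs_cat | rewrite /J idl_cat].
have nf := nzd_dim hJ hl nl ml hf mf.
(* [HF J j] is the sum of the values of [HF (adj J l)] up to [j], since [l] is a nonzerodivisor. *)
have hle j : (HF J j <= \prod_(x <- fs) x.1)%N.
  have := HF_sum j.+1 hJ hl nl; rewrite subn1 /= [RHS]big_ord_recr /= addnC => /addnI <-.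
  exact: sm.
split.
- by rewrite -cats1; apply/regs_cat.
- move=> B; rewrite -cats1 big_cat big_seq1 /=.
  have := HF_sum B hJ hf nf; set S := (\sum_(j < B) HF (adj J f) j)%N.
  (* Telescoping leaves at most [d] values of [HF J], each bounded by [hle]. *)
  have -> : (\sum_(j < B) HF J j =
    \sum_(j < B - d) HF J j + \sum_(i < B - (B - d)) HF J (B - d + i))%N.
    have eB : B = (B - d + (B - (B - d)))%N by lia.
    by rewrite [in LHS]eB big_split_ord.
  rewrite addnC => /addnI ->.
  apply: leq_trans (leq_sum _ (fun i _ => hle _)) _.
  rewrite sum_nat_const card_ord mulnC leq_mul2l; apply/orP; right; lia.
- by rewrite -cats1 big_cat big_seq1; apply: (soc_exchange hJ hl).
Qed.

End CI.
Arguments posform {k N} x.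

(** * Principal ideals of Artinian complete intersections *)

Section Reduce.
Variables (k : closedFieldType) (N : nat).
Local Notation P := {mpoly k[N]}.
Local Notation pt := ('I_N -> k).
Implicit Types (J : P -> Prop) (s : seq (nat * P)) (x : nat * P).

Lemma idl_van J s (v : pt) : (forall u, J u -> u.@[v] = 0) ->
  (forall x, x \in s -> x.2.@[v] = 0) -> forall u, idl J s u -> u.@[v] = 0.
Proof.
elim: s J => //= x s IH J hJ hs; apply: IH => [u [b /hJ]|y ys].
  by rewrite mevalB mevalM hs ?mem_head // mulr0 subr0.
by apply: hs; rewrite inE ys orbT.
Qed.

Lemma adj_eqm J (a b : P) : gideal J -> J (a - b) -> adj J a = adj J b.
Proof.
move=> hJ hab; apply: pred_ext => u; split=> [] [c hc]; exists c.
  by have := giD hJ hc (giM c hJ hab); congr J; ring.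
by have := giB hJ hc (giM c hJ hab); congr J; ring.
Qed.

(* General combinations of the forms [fs], taken by decreasing degree, can
   replace the linear forms [L] one at a time. *)
Lemma reduce L : forall J fs, gideal J ->
  all (fun x => posform x && (x.1 == 1%N)) L -> all posform fs ->
  sorted geq (map fst fs) -> (size L <= size fs)%N ->
  mprim (idl J L) -> mprim (idl J fs) ->
  exists gs, [/\ all posform gs, map fst gs = take (size L) (map fst fs),
    forall x, x \in gs -> idl J fs x.2 & mprim (idl J gs)].
Proof.
elim: L => [|[e l] L IH] J fs hJ; first by move=> _ _ _ _ hm _; exists [::]; rewrite take0.
move=> /= /andP [/andP [/andP [/= _ hl] /eqP e1] hL]; rewrite e1 in hl.
case: fs => [//|[d f] fs] /= /andP [/andP [/= d0 hf] hfs] srt.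
rewrite ltnS => sz; rewrite !idl_adj => mL mfs.
have hL' : all posform L by apply: sub_all hL => y /andP [].
have hJL : gideal (idl J L) by exact: idl_gideal.
have hJf : gideal (idl J fs) by exact: idl_gideal.
have [r [p [hp Jp hc]]] := zeros_cover hJL hl (ltn0Sn 0) mL.
(* All members have degree [d]. [f] comes first, so it enters [g] with coefficient [y ^+ 0 = 1] and
   [g = f] modulo the remaining forms. *)
pose hs := f :: [seq 'X_t ^+ (d - x.1) * x.2 | x <- fs, t <- enum 'I_N].
have le x : x \in fs -> (x.1 <= d)%N.
  move=> hx; have tr : transitive geq by move=> y z w; rewrite /geq /=; lia.
  have /allP := order_path_min tr srt; apply; exact: map_f.
have hhs h : h \in hs -> homd d h.
  rewrite inE => /orP [/eqP -> //|/allpairsP [[x a] [/= hx _ ->]]].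
  have /allP /(_ _ hx) /andP [_ hxf] := hfs.
  rewrite -[X in homd X](subnK (le _ hx)); apply: homM => //.
  by apply: hom_exp1; exact: hom_X.
have [|y hy] := @avoid N k r p hs.
  (* If all of [hs] vanished at [p i], so would the ideal [(J, f, fs)], which contains a power of
     every variable. *)
  move=> i; apply: NNPP => no; have [a pa] := hp i.
  have Jpi u : J u -> u.@[p i] = 0 by move=> Ju; apply: Jp; exact: sub_idl.
  have f0 : f.@[p i] = 0.
    by apply/eqP/negPn/negP => n; apply: no; exists f => //; exact: mem_head.
  have fs0 x : x \in fs -> x.2.@[p i] = 0.
    move=> hx; apply/eqP/negPn/negP => n; apply: no; exists ('X_a ^+ (d - x.1) * x.2).
      rewrite inE; apply/orP; right; apply/allpairsP; exists (x, a).
      by rewrite mem_enum.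
    by rewrite mevalM rmorphXn /= mevalXU mulf_neq0 ?expf_neq0.
  have [M hM] := mfs; have [b hb] := hM M ('X_a ^+ M) (leqnn M) (hom_exp1 M (hom_X k a)).
  have := idl_van Jpi fs0 hb; rewrite mevalB mevalM f0 mulr0 subr0 rmorphXn /= mevalXU.
  by move=> /eqP; rewrite expf_eq0 (negbTE pa) andbF.
set g := \sum_(j < size hs) _ in hy.
have hg : homd d g.
  apply: subsp_sum => [|j _]; first exact: hom_subsp.
  by apply: subspZ; [exact: hom_subsp | apply: hhs; exact: mem_nth].
have gf : idl J fs (g - f).
  rewrite /g /= big_ord_recl /= expr0 scale1r addrC addKr.
  apply: subsp_sum => [|j _]; first exact: gi_subsp.
  apply: giZ => //; have /allpairsP [[x a] [/= hx _ ->]] := mem_nth 0 (ltn_ord j).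
  by apply: giM => //; exact: mem_idl.
have mg := mprim_avoid hJL hg hc hy.
have egf : adj (idl J fs) g = adj (idl J fs) f by exact: adj_eqm.
have [||||gs [h1 h2 h3 h4]] := IH (adj J g) fs (adj_gideal hJ hg) hL hfs.
- exact: path_sorted srt.
- by [].
- by rewrite idl_adj.
- by rewrite idl_adj egf.
exists ((d, g) :: gs); split=> /=.
- by rewrite h1 /posform /= d0 hg.
- by rewrite h2.
- move=> x; rewrite inE => /orP [/eqP -> /=|/h3]; last by rewrite idl_adj egf.
  by rewrite -egf; exact: adj_self.
- exact: h4.
Qed.

Lemma HF_zeroid1E : HF (@zeroid k N) 1 = N.
Proof.
have hz := @zeroid_gideal k N; apply/eqP; rewrite eqn_leq HF_zeroid1 andbT.
apply: (qdim_le (gi_subsp hz) (HFP 1 hz)); exists (fun i => 'X_i) => u hu.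
by exists (fun i => u@_U_(i)); rewrite {1}(homX_span hu) subrr.
Qed.

(** [W] is a basis of the linear forms in [Q] and [L] lifts a basis of the linear forms modulo [Q];
    together they generate the irrelevant ideal. *)
Lemma split_linear (Q : P -> Prop) : gideal Q ->
  exists W L, [/\ all (fun x => posform x && (x.1 == 1%N)) W,
    all (fun x => posform x && (x.1 == 1%N)) L,
    size L = HF Q 1 /\ (size W + size L)%N = N, forall x, x \in W -> Q x.2
    & mprim (idl (@zeroid k N) (W ++ L))].
Proof.
move=> hQ; have hz := @zeroid_gideal k N.
pose A u := homd 1 u /\ Q u.
have sA : subsp A.
  split; first by split; [case: (hom_subsp k N 1) | exact: gi0].
  move=> c u v [h1 h2] [h3 h4]; split; first by apply: (proj2 (hom_subsp k N 1)).
  by apply: (proj2 (gi_subsp hQ)).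
have [t ht] : exists t, qdim A (@zeroid k N) t.
  by apply: (HFP0 (j := 1%N)) (gi_subsp hz) _ => // u [].
have e : (t + HF Q 1 = N)%N.
  rewrite -[RHS]HF_zeroid1E; apply: (qdim_uniq (gi_subsp hz) _ (HFP 1 hz)).
  apply: (qdim_exact (f := idfun) _ _ _ _ _ _ _ _ _ _ ht (HFP 1 hQ)) => //=;
    try exact: gi_subsp; try exact: hom_subsp.
  - by move=> u [].
  - by move=> u ->; exact: gi0.
  - by move=> u [].
  - by move=> u h1 h2; exists u => //; rewrite subrr.
have [w [wA _ ws]] := ht; have [l [lA _ ls]] := HFP 1 hQ.
pose W := [seq (1%N, w i) | i <- enum 'I_t].
pose L := [seq (1%N, l i) | i <- enum 'I_(HF Q 1)].
have hW : all (fun x => posform x && (x.1 == 1%N)) W.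
  by apply/allP => x /mapP [i _ ->]; rewrite /posform /= andbT; case: (wA i).
have hL : all (fun x => posform x && (x.1 == 1%N)) L.
  by apply/allP => x /mapP [i _ ->]; rewrite /posform /= andbT; exact: (lA i).
have hWL : all posform (W ++ L).
  by rewrite all_cat; apply/andP; split; [apply: sub_all hW | apply: sub_all hL] => y /andP [].
have hI := idl_gideal hz hWL.
exists W, L; split=> //.
- by rewrite !size_map -!enumT !size_enum_ord.
- by move=> x /mapP [i _ ->]; case: (wA i).
exists 1%N => -[|j] // u _; apply: gen_all => // i.
have [c hc] := ls _ (hom_X k i).
have [|c' hc'] := ws ('X_i - \sum_j c j *: l j).
  split=> //; apply: subspB; [exact: hom_subsp | exact: hom_X |].
  by apply: subsp_sum => [|? _]; [exact: hom_subsp | apply: subspZ => //; exact: hom_subsp].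
move/subr0_eq: hc' => hc'; rewrite -(subrK (\sum_j c j *: l j) 'X_i) hc'.
apply: giD => //; apply: subsp_sum => [|j' _]; try exact: gi_subsp; apply: giZ => //.
  by apply: (mem_idl (x := (1%N, w j'))) => //; rewrite mem_cat map_f ?mem_enum.
by apply: (mem_idl (x := (1%N, l j'))) => //; rewrite mem_cat orbC map_f ?mem_enum.
Qed.

(** * An Artinian complete intersection of [N] forms in [N] variables *)

Section Fixed.
Variable fs : seq (nat * P).
Hypotheses (hfs : all posform fs) (sfs : size fs = N) (mfs : mprim (idl (@zeroid k N) fs)).
Local Notation I := (idl (@zeroid k N) fs).
Local Notation sg := (\sum_(x <- fs) (x.1 - 1))%N.

Lemma I_gideal : gideal I.
Proof. exact: idl_gideal (@zeroid_gideal k N) hfs. Qed.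

Lemma I_ci : (forall B, (\sum_(j < B) HF I j <= \prod_(x <- fs) x.1)%N) /\ soc I sg.
Proof. by have [] := @ci_theorem k N N fs [::] sfs (add0n N) isT hfs mfs. Qed.

(** With [W] the linear forms killing [u], [reduce] completes [W] by forms [gs] of the largest
    degrees to a complete intersection inside [I : u]. Degrees being sorted decreasingly, [drop]
    keeps the smallest ones. *)
Lemma annihilator_degree e u : sorted geq (map fst fs) -> homd e u -> ~ I u ->
  (\sum_(i <- drop (HF (colon I u) 1) (map fst fs)) (i - 1) <= e)%N.
Proof.
move=> srt hu nu; have hz := @zeroid_gideal k N; have hI := I_gideal; have [_ sI] := I_ci.
have hQ := colon_gideal hI hu.
have [W [L [hW hL [sL sWL] WQ mWL]]] := split_linear hQ.
have hW' : all posform W by apply: sub_all hW => y /andP [].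
have hJ := idl_gideal hz hW'.
have hJf : gideal (idl (idl (@zeroid k N) W) fs) by exact: idl_gideal.
have IJ : forall v, I v -> idl (idl (@zeroid k N) W) fs v.
  apply: idl_min => // [v ->|x hx]; first exact: gi0.
  exact: mem_idl.
rewrite idl_cat in mWL.
have [|gs [g1 g2 g3 g4]] := reduce hJ hL hfs srt _ mWL (mprim_sub IJ mfs).
  by rewrite sfs; lia.
have sgs : size gs = HF (colon I u) 1.
  have := congr1 size g2; rewrite size_map size_take size_map sfs -sL => ->.
  by case: ltnP => //; lia.
have subQ : forall v, idl (@zeroid k N) (W ++ gs) v -> colon I u v.
  have JQ : forall v, idl (idl (@zeroid k N) W) fs v -> colon I u v.
    apply: idl_min => // [|x hx]; last by apply: sub_colon => //; exact: mem_idl.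
    apply: idl_min => // [v ->]; exact: gi0.
  apply: idl_min => // [v ->|x]; first exact: gi0.
  by rewrite mem_cat => /orP [/WQ|/g3 /JQ].
rewrite -idl_cat in g4.
have [|_ _ sG] := ci_theorem sgs _ hW g1 g4; first by rewrite -sL.
have hG : gideal (idl (@zeroid k N) (W ++ gs)) by apply: idl_gideal; rewrite // all_cat hW'.
(* Duality yields [v] of degree [sg - e] outside [I : u], hence outside [(W, gs)]; so [sg - e] is at
   most the socle degree of [(W, gs)]. *)
have [le [v [hv nv]]] := soc_pair hI mfs sI hu nu.
have [] := soc_pair hG g4 sG hv; first by move/subQ.
have -> : (\sum_(x <- gs) (x.1 - 1) = \sum_(i <- take (size L) (map fst fs)) (i - 1))%N.
  by rewrite -g2 big_map.
have : (sg = \sum_(i <- map fst fs) (i - 1))%N by rewrite big_map.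
rewrite -{1}(cat_take_drop (size L) (map fst fs)) big_cat /= sL.
by move: le; set A := (\sum_(x <- fs) _)%N; lia.
Qed.

(** * Symmetry and growth of the Hilbert function of a principal ideal *)

Section Principal.
Variables (D : nat) (g : P).
Hypotheses (hg : homd D g) (ng : ~ I g).
Local Notation h := (HF (colon I g)).

Lemma D_le : (D <= sg)%N.
Proof. by have [_ sI] := I_ci; have [] := soc_pair I_gideal mfs sI hg ng. Qed.

Lemma principal_sum B : (\sum_(j < B) HF (adj I g) j + \sum_(j < B - D) h j =
  \sum_(j < B) HF I j)%N.
Proof.
have hI := I_gideal; elim: B => [|B IH]; first by rewrite !big_ord0.
rewrite big_ord_recr [RHS]big_ord_recr /= -IH; case: (ltnP B D) => hB.
  have -> : (B.+1 - D = 0)%N by lia.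
  have -> : (B - D = 0)%N by lia.
  by rewrite big_ord0 !addn0 (HF_adj_lt hI hg).
rewrite subSn // big_ord_recr /=; have := HF_exact (B - D) hI hg.
by rewrite subnK // => ->; rewrite addnACA; congr addn; rewrite addnC.
Qed.

(** The pairing [(u, v) -> g u v] into the one-dimensional degree [sg] is nondegenerate on
    [P / (I : g)]; [A] is its matrix in degrees [i] and [sg - D - i]. *)
Lemma principal_sym_le i : (i <= sg - D)%N -> (h i <= h (sg - D - i))%N.
Proof.
move=> hi; have hI := I_gideal; have hQ := colon_gideal hI hg.
have [_ sI] := I_ci; have [_ hs] := sI; have dle := D_le.
have [e [eA ei es]] := HFP i hQ; have [f [fA fi f_s]] := HFP (sg - D - i) hQ.
have := HFP sg hI; rewrite hs => -[w [_ _ ws]].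
have hM (y : 'I_(h i) * 'I_(h (sg - D - i))) :
    exists c : k, I (g * (e y.1 * f y.2) - c *: w ord0).
  have hx : homd sg (g * (e y.1 * f y.2)).
    have := homM hg (homM (eA y.1) (fA y.2)).
    by rewrite subnKC // subnKC.
  by have [c] := ws _ hx; rewrite big_ord1; exists (c ord0).
have [M hM'] := fin_all_exists hM.
rewrite leqNgt; apply/negP => lt.
pose A : 'M[k]_(h i, h (sg - D - i)) := \matrix_(a, b) M (a, b).
have : kermx A != 0.
  rewrite kermx_eq0 /row_free; apply: contraL lt => /eqP <-.
  by rewrite -leqNgt rank_leq_col.
move=> /rowV0Pn [v /sub_kermxP vA v0].
move/negP: v0; apply; apply/eqP/rowP => a; rewrite mxE.
apply: (ei (fun i => v 0 i)); set u := \sum_ _ _.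
have hu : homd i u.
  by apply: subsp_sum => [|? _]; [exact: hom_subsp | apply: subspZ => //; exact: hom_subsp].
have ufI b : I (g * (u * f b)).
  have -> : g * (u * f b) = \sum_a v 0 a *: (g * (e a * f b) - M (a, b) *: w ord0).
    under [RHS]eq_bigr do rewrite scalerBr scalerA.
    rewrite sumrB -scaler_suml; move/rowP: vA => /(_ b); rewrite !mxE => vA.
    rewrite (_ : \sum_a v 0 a * M (a, b) = 0); last first.
      by rewrite -[RHS]vA; apply: eq_bigr => c _; rewrite mxE.
    rewrite scale0r subr0 /u mulr_suml mulr_sumr; apply: eq_bigr => c _.
    by rewrite -scalerAl -scalerAr.
  apply: subsp_sum => [|c _]; first exact: gi_subsp.
  by apply: giZ => //; exact: (hM' (c, b)).
apply: NNPP => nu.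
(* Duality gives [z] with [g u z] outside [I], but [z] is a combination of the [f b] modulo [I : g],
   and each [g u f b] lies in [I]. *)
have [_ [z [hz nz]]] := soc_pair hI mfs sI (homM hg hu) nu.
apply: nz; rewrite subnDA in hz; have [c hc] := f_s _ hz.
have := giD hI (giM u hI hc) (_ : I (\sum_b c b *: (g * (u * f b)))); rewrite /colon.
set S := \sum_b c b *: f b; rewrite (_ : \sum_b _ = g * (u * S)).
  move=> H; have := H _; set q := I (g * (u * S)) => H'.
  have : q.
    rewrite /q /S mulr_sumr mulr_sumr; apply: subsp_sum => [|b _]; first exact: gi_subsp.
    by rewrite -!scalerAr; apply: giZ.
  by move/H'; congr (idl _ _ _); ring.
by rewrite /S mulr_sumr mulr_sumr; apply: eq_bigr => b _; rewrite -!scalerAr.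
Qed.

Lemma principal_sym i : (i <= sg - D)%N -> h i = h (sg - D - i).
Proof.
move=> hi; apply/eqP; rewrite eqn_leq principal_sym_le //=.
by have := principal_sym_le (leq_subr i (sg - D)); rewrite subKn.
Qed.

(** If [g] killed all of degree [i], it would kill all of degree [sg - D] as well, against duality
    for [g]. *)
Lemma principal_nz i : (i <= sg - D)%N -> exists v, homd i v /\ ~ I (g * v).
Proof.
move=> hi; apply: NNPP => no; have hI := I_gideal; have hQ := colon_gideal hI hg.
have [_ sI] := I_ci; have [_ [v [hv nv]]] := soc_pair hI mfs sI hg ng; apply: nv.
have all_ge j : forall m : 'X_{1..N}, mdeg m = (i + j)%N -> colon I g 'X_[m].
  elim: j => [|j IH] m; rewrite ?addn0 ?addnS => hm.
    apply: NNPP => n; apply: no; exists 'X_[m]; split=> //.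
    by rewrite /homd dhomogX; apply/eqP.
  by have [a [m' [/IH h' ->]]] := mon_step k hm; exact: giM.
apply: (homd_ind (gi_subsp hQ)) hv => m hm; apply: (all_ge (sg - D - i)%N).
by rewrite hm subnKC.
Qed.

(** Multiplication by [v] embeds the linear forms modulo [I : g v] into degree [i + 1] modulo
    [I : g]; [annihilator_degree] is then applied to [g v], of degree [D + i]. *)
Lemma principal_growth i : sorted geq (map fst fs) -> (i < sg - D)%N ->
  (\sum_(j <- drop (h i.+1) (map fst fs)) (j - 1) <= D + i)%N.
Proof.
move=> srt hi; have [v [hv nv]] := principal_nz (ltnW hi).
have hI := I_gideal; have hQ := colon_gideal hI hg; have hgv := homM hg hv.
have hC := colon_gideal hI hgv.
have le : (HF (colon I (g * v)) 1 <= h i.+1)%N.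
  have [e [eA ei es]] := HFP 1 hC.
  apply: (qdim_ge (gi_subsp hQ) (HFP i.+1 hQ)); exists (fun j => v * e j); split.
    by move=> j; rewrite -addn1; exact: homM.
  move=> c hc; apply: ei; move: hc; rewrite /colon; congr (idl _ _ _).
  rewrite -mulrA; congr (_ * _); rewrite mulr_sumr; apply: eq_bigr => j _.
  by rewrite scalerAr.
apply: leq_trans (annihilator_degree srt hgv nv).
set r := HF _ 1 in le *; set t := map fst fs.
have -> : drop r t = take (h i.+1 - r) (drop r t) ++ drop (h i.+1) t.
  by rewrite -[LHS](cat_take_drop (h i.+1 - r)) drop_drop subnK.
by rewrite big_cat leq_addl.
Qed.

End Principal.
End Fixed.
End Reduce.

(** * The lexicographic monomials *)

Local Close Scope ring_scope.

Section Lex.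
Variables (n : nat) (d : 'I_n -> nat).
Local Notation M := (mon d).
Local Notation ds := [seq d i | i <- enum 'I_n].

(** Multiplication by [x_i]; [inord] is exact when [a i < d i], because [d i < expB d]. *)
Definition bump_mon (a : M) (i : 'I_n) : M :=
  [ffun j => if j == i then inord (a j).+1 else a j].

Lemma bump_monE (a : M) i j : a i < d i -> bump_mon a i j = a j + (j == i) :> nat.
Proof.
move=> h; rewrite ffunE; case: eqP => [->|_]; last by rewrite addn0.
rewrite inordK ?addn1 // /expB ltnS; apply: leq_trans h _.
by rewrite (bigD1 i) //= leq_addr.
Qed.

Lemma sum_eq1 (i : 'I_n) : \sum_j ((j == i) : nat) = 1.
Proof. by rewrite (bigD1 i) //= eqxx big1 // => j /negbTE ->. Qed.

Lemma mdegree_bump (a : M) i : a i < d i -> mdegree (bump_mon a i) = (mdegree a).+1.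
Proof.
move=> h; rewrite /mdegree (eq_bigr (fun j => a j + (j == i))).
  by rewrite big_split /= sum_eq1 addn1.
by move=> j _; exact: bump_monE.
Qed.

Lemma adm_ex E : (forall i, 1 <= d i) -> E <= sigma_d d -> exists a : M, adm d E a.
Proof.
move=> d1; elim: E => [_|E IH lt].
  exists [ffun _ => ord0]; rewrite /adm; apply/andP; split.
    by apply/forallP => i; rewrite ffunE; exact: d1.
  by rewrite /mdegree big1 // => i _; rewrite ffunE.
have [a /andP [/forallP a1 /eqP a2]] := IH (ltnW lt).
case: (pickP (fun i => a i + 1 < d i)) => [i hi|h].
  have hi' : a i < d i by lia.
  exists (bump_mon a i); apply/andP; split; last by rewrite mdegree_bump // a2.
  apply/forallP => j; rewrite bump_monE //; case: eqP => [->|_]; first by [].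
  by rewrite addn0; exact: a1.
suff : sigma_d d <= mdegree a by lia.
apply: leq_sum => i _; have := h i; lia.
Qed.

(** The maximum is taken in the total lexicographic order on exponent tuples and translated into
    [lexle]. *)
Lemma lex_max_ex E (a0 : M) : adm d E a0 ->
  exists a, adm d E a && [forall b : M, adm d E b ==> lexle b a].
Proof.
move=> h0; pose F (a : M) : n.-tuplelexi nat := [tuple (a i : nat) | i < n].
case: (@Order.TotalTheory.arg_maxP _ _ _ a0 (adm d E) F h0) => a ha hmax.
exists a; rewrite ha; apply/forallP => b; apply/implyP => hb.
have /Order.TupleLexiOrder.Exports.lexi_tupleP [l hl] : (F b <= F a)%O := hmax b hb.
have ev (i : 'I_n) : i <= l -> (b i : nat) <= a i ?= iff (i != l :> nat).
  move=> le; have := hl i le; rewrite !tnth_mktuple => h.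
  by split; [exact: h.1 | exact: h.2].
case: (ltnP l n) => ln; last first.
  apply/orP; left; apply/eqP/ffunP => i; apply: val_inj; apply/eqP.
  have lt : i < l by apply: leq_trans ln.
  by rewrite (ev i (ltnW lt)).2 neq_ltn lt.
apply/orP; right; apply/existsP; exists (Ordinal ln); apply/andP; split.
  have := ev (Ordinal ln) (leqnn _); rewrite /= eqxx => -[h1 h2].
  by rewrite ltn_neqAle h2 h1.
apply/forallP => j; apply/implyP => /= lt.
by rewrite (ev j (ltnW lt)).2 neq_ltn lt.
Qed.

Lemma U_EP E : (forall i, 1 <= d i) -> E <= sigma_d d ->
  adm d E (U_E d E) /\ forall b, adm d E b -> lexle b (U_E d E).
Proof.
move=> d1 hE; rewrite /U_E; case: pickP => [a /andP [h1 /forallP h2]|h] /=.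
  by split=> // b; apply/implyP.
have [a0 h0] := adm_ex d1 hE; have [a ha] := lex_max_ex h0.
by have := h a; rewrite ha.
Qed.

Lemma mem_take_enum t (i : 'I_n) : (i \in take t (enum 'I_n)) = (i < t).
Proof. by rewrite in_take ?mem_enum // index_enum_ord. Qed.

Lemma mem_drop_enum t (i : 'I_n) : i \in drop t (enum 'I_n) -> t <= i.
Proof.
move=> hi; rewrite leqNgt -mem_take_enum; apply/negP => ht.
have := enum_uniq 'I_n; rewrite -(cat_take_drop t (enum 'I_n)) cat_uniq.
by case/and3P => _ /hasPn /(_ _ hi) /negP.
Qed.

(** If [x_i] with [i < t] is not at its maximal exponent, either a later variable can be traded for
    [x_i], giving a lex-larger monomial, or only the first [t] variables occur and the degree is too
    small. *)
Lemma U_full t E : (forall i, 1 <= d i) -> E <= sigma_d d ->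
  \sum_(x <- take t ds) (x - 1) <= E -> forall i : 'I_n, i < t -> d i <= (U_E d E i).+1.
Proof.
move=> d1 hE ht i it; have [/andP [/forallP U1 /eqP U2] Um] := U_EP d1 hE.
set U := U_E d E in U1 U2 Um *; rewrite leqNgt; apply/negP => hi.
case: (pickP (fun j : 'I_n => (t <= j) && (0 < U j))) => [j /andP [tj Uj]|h].
  have ij : i != j by apply: contraTneq tj => <-; rewrite -ltnNge.
  have hi' : U i < d i by lia.
  (* The monomial [U x_i / x_j]. *)
  pose b : M := [ffun l => if l == j then inord (U j).-1 else bump_mon U i l].
  have bE l : b l = U l + (l == i) - (l == j) :> nat.
    rewrite ffunE; case: (eqVneq l j) => [->|_]; last by rewrite bump_monE // subn0.
    rewrite inordK; first by rewrite eq_sym (negbTE ij) addn0 subn1.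
    exact: leq_ltn_trans (leq_pred _) (ltn_ord (U j)).
  have hb : adm d E b.
    apply/andP; split.
      apply/forallP => l; rewrite bE; have := U1 l.
      by case: (eqVneq l i) => [->|_]; lia.
    have e1 : mdegree b + 1 = mdegree U + 1.
      have -> : mdegree b + 1 = \sum_l (b l + (l == j)).
        by rewrite big_split /= sum_eq1.
      have -> : mdegree U + 1 = \sum_l (U l + (l == i)).
        by rewrite big_split /= sum_eq1.
      by apply: eq_bigr => l _; rewrite bE; case: (eqVneq l j) => [->|_]; lia.
    by apply/eqP; lia.
  have := Um b hb; rewrite /lexle => /orP [/eqP e|/existsP [l /andP [lt /forallP eq]]].
    by have := bE i; rewrite e eqxx (negbTE ij); lia.
  have lj : l = j.
    by apply/eqP/negPn/negP => ne; move: lt; rewrite bE (negbTE ne); lia.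
  have := eq i; rewrite lj (leq_trans it tj) /= bE eqxx (negbTE ij).
  by move=> /eqP; lia.
suff : E < \sum_(x <- take t ds) (x - 1) by lia.
rewrite -map_take big_map -U2 /mdegree -big_enum /=.
rewrite -{1}(cat_take_drop t (enum 'I_n)) big_cat /=.
rewrite [X in _ + X < _]big1_seq ?addn0; last first.
  move=> j /andP [_ /mem_drop_enum tj]; have := h j; rewrite tj /=.
  by case: (U j : nat).
have ui := take_uniq t (enum_uniq 'I_n).
rewrite (bigD1_seq i) ?mem_take_enum //= [X in _ < X](bigD1_seq i) ?mem_take_enum //=.
rewrite -addSn; apply: leq_add; first by lia.
by apply: leq_sum => j _; have := U1 j; lia.
Qed.

(** [phi d m] counts the monomials [U x_i] outside [(x^d)], and [i < t] is excluded because those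
    exponents of [U] are already maximal. *)
Lemma phi_le t m : (forall i, 1 <= d i) -> t <= n -> 2 <= m <= sigma_d d ->
  \sum_(x <- take t ds) (x - 1) <= m.-1 -> (phi d m <= Posz (n - t))%R.
Proof.
move=> d1 tn hm ht; rewrite /phi hm; case/andP: hm => m2 ms.
have mE : m.-1 <= sigma_d d by lia.
have full := U_full d1 mE ht; have [/andP [/forallP U1 /eqP U2] _] := U_EP d1 mE.
rewrite /HF_xd /HF_L; set U := U_E d m.-1 in full U1 U2 *.
pose S := [set a : M | adm d m a && mdivides U a].
have -> : #|[set a : M | adm d m a]| =
    #|S| + #|[set a : M | adm d m a && ~~ mdivides U a]|.
  rewrite -(cardsID [set a | mdivides U a]); congr (_ + _); apply: eq_card => a;
  by rewrite !inE // andbC.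
rewrite PoszD GRing.addrK lez_nat.
have sub : S \subset [set bump_mon U i | i in [pred i : 'I_n | t <= i]].
  apply/subsetP => a; rewrite inE => /andP [/andP [/forallP a1 /eqP a2] /forallP a3].
  have e1 : \sum_i (a i - U i) = 1.
    have : \sum_i (a i - U i) + mdegree U = mdegree a.
      by rewrite /mdegree -big_split /=; apply: eq_bigr => i _; rewrite subnK.
    by rewrite U2 a2; lia.
  case: (pickP (fun i => 0 < a i - U i)) => [i hi|h]; last first.
    by move: e1; rewrite big1 // => i _; have := h i; lia.
  move: e1; rewrite (bigD1 i) //= => e1.
  have e0 : \sum_(j | j != i) (a j - U j) = 0.
    by move: hi e1; case: (a i - U i) => [|x] //; case: (\sum_(_ | _) _) => // y; rewrite addnS addSn.
  have ai : (a i : nat) = (U i).+1.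
    by move: e1; rewrite e0 addn0 => e2; rewrite -(subnK (a3 i)) e2 add1n.
  have Ui : U i < d i by apply: ltnW; rewrite -ai; exact: a1.
  apply/imsetP; exists i.
    by rewrite inE leqNgt; apply/negP => it; have := full i it; rewrite -ai leqNgt a1.
  apply/ffunP => j; apply: val_inj; rewrite /= bump_monE //.
  case: (eqVneq j i) => [->|ne]; first by rewrite addn1.
  move/eqP: e0; rewrite sum_nat_eq0 => /forallP /(_ j); rewrite ne /= => /eqP e0.
  by rewrite -[LHS](subnK (a3 j)) e0 addn0.
apply: leq_trans (subset_leq_card sub) _; apply: leq_trans (leq_imset_card _ _) _.
have e := cardC [pred i : 'I_n | t <= i]; rewrite card_ord in e.
suff h : t <= #|predC [pred i : 'I_n | t <= i]|.
  by rewrite leq_subRL // -[X in _ <= X]e addnC leq_add2l.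
have inj : injective (widen_ord tn) by move=> x y /(congr1 val) /= ?; exact: val_inj.
rewrite -[X in X <= _]card_ord -(card_imset _ inj).
apply: subset_leq_card; apply/subsetP => i /imsetP [j _ ->].
by rewrite !inE /= -ltnNge.
Qed.

End Lex.

Local Open Scope ring_scope.

(** * Counting the points *)

(** The two ends contribute at least 1 each. Of the [a + b] inner values the first [b] are kept, and
    the last [a] are reflected onto [h 1, .., h a]. *)
Lemma half_sum (h : nat -> nat) a b : (0 < h 0)%N ->
  (forall i, (i <= (a + b).+1)%N -> h i = h ((a + b).+1 - i)%N) ->
  (\sum_(i < a) h i.+1 + \sum_(i < b) h i.+1 + 2 <= \sum_(i < (a + b).+2) h i)%N.
Proof.
move=> h0 sym; rewrite big_ord_recl [X in (_ <= _ + X)%N]big_ord_recr /=.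
have -> : \sum_(i < a) h i.+1 = \sum_(i < a) h (b + i).+1.
  rewrite (reindex_inj rev_ord_inj) /=; apply: eq_bigr => i _; rewrite sym; last by lia.
  by congr h; have := ltn_ord i; lia.
rewrite (addnC a b) big_split_ord /=.
have hK : (0 < h (b + a).+1)%N by rewrite sym addnC // subnn.
move: (\sum_(i < a) _)%N (\sum_(i < b) _)%N => A B; rewrite /bump /= add1n; lia.
Qed.

Lemma sum_le_Posz (f : nat -> int) (h : nat -> nat) c :
  (forall i, (i < c)%N -> f i <= Posz (h i)) -> \sum_(i < c) f i <= Posz (\sum_(i < c) h i).
Proof.
elim: c => [|c IH] hf; first by rewrite !big_ord0.
rewrite !big_ord_recr PoszD lerD ?hf //; apply: IH => i hi; apply: hf; exact: ltnW.
Qed.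

(** * The complete intersection cut by a linear form without zeros on it *)

Section Main.
Variables (k : closedFieldType) (n : nat) (d : 'I_n -> nat) (F : 'I_n -> {mpoly k[n.+1]}).
Hypotheses (d1 : forall i, (1 <= d i)%N)
  (dm : forall i j : 'I_n, (i <= j)%N -> (d i <= d j)%N).
Hypothesis hF : forall i, homog_of (d i) (F i).
Local Notation pt := ('I_n.+1 -> k).

(** Reversed, so that the degrees decrease as [reduce] requires. *)
Definition Fforms : seq (nat * {mpoly k[n.+1]}) := [seq (d i, F i) | i <- rev (enum 'I_n)].
Local Notation J0 := (idl (@zeroid k n.+1) Fforms).

Lemma Fforms_form : all posform Fforms.
Proof. by apply/allP => x /mapP [i _ ->]; rewrite /posform /= d1; exact: hF. Qed.

Lemma J0_gideal : gideal J0.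
Proof. exact: idl_gideal (@zeroid_gideal k n.+1) Fforms_form. Qed.

Lemma J0_zero (v : pt) : (forall u, J0 u -> u.@[v] = 0) <-> forall i, vanishes_at (F i) v.
Proof.
split=> [h i|h].
  apply: h; apply: (mem_idl (x := (d i, F i)) (@zeroid_gideal k n.+1) Fforms_form).
  by apply: map_f; rewrite mem_rev mem_enum.
apply: idl_van => [u ->|x /mapP [i _ ->]]; [exact: meval0 | exact: h].
Qed.

Variable l : {mpoly k[n.+1]}.
Hypotheses (hl : homd 1 l) (ml : mprim (adj J0 l)).
Hypothesis lv : forall v, in_zeroset F v -> l.@[v] != 0.
Local Notation fs := (rcons Fforms (1%N, l)).
Local Notation I := (idl (@zeroid k n.+1) fs).

Lemma I_adj : I = adj J0 l. Proof. by rewrite idl_rcons. Qed.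

Lemma fs_form : all posform fs.
Proof. by rewrite all_rcons Fforms_form /posform andbT; exact: hl. Qed.

Lemma fs_size : size fs = n.+1.
Proof. by rewrite size_rcons size_map size_rev size_enum_ord. Qed.

Lemma fs_mprim : mprim I. Proof. by rewrite I_adj. Qed.

Lemma fs_degrees : map fst fs = rcons (rev [seq d i | i <- enum 'I_n]) 1%N.
Proof. by rewrite map_rcons -map_comp -map_rev; congr rcons; apply: eq_map. Qed.

Lemma fs_sorted : sorted geq (map fst fs).
Proof.
rewrite fs_degrees -rev_cons rev_sorted.
have e : sorted leq [seq d i | i <- enum 'I_n].
  rewrite sorted_map; apply: (sub_sorted (e := fun i j : 'I_n => (i <= j)%N)).
    by move=> i j; exact: dm.
  by have := iota_sorted 0 n; rewrite -val_enum_ord sorted_map.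
have : all (leq 1) [seq d i | i <- enum 'I_n] by apply/allP => x /mapP [i _ ->].
by move: e; case: [seq d i | i <- enum 'I_n] => //= x s -> /andP [-> _].
Qed.

Lemma fs_sigma : (\sum_(x <- fs) (x.1 - 1) = sigma_d d)%N.
Proof.
rewrite -cats1 big_cat big_seq1 /= addn0 big_map /=.
by rewrite (perm_big (enum 'I_n)) ?perm_rev // /sigma_d big_enum.
Qed.

Lemma fs_prod : (\prod_(x <- fs) x.1 = \prod_(i < n) d i)%N.
Proof.
rewrite -cats1 big_cat big_seq1 /= muln1 big_map /=.
by rewrite (perm_big (enum 'I_n)) ?perm_rev // big_enum.
Qed.

(** While [G] lies in [I = J0 + (l)], it equals [b l] modulo [J0]. Since [l] has no zero on Gamma,
    [b] has the same zeros there and smaller degree; in degree 0 the cofactor is 0, against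
    [G(v) != 0]. *)
Lemma descend (S : pt -> Prop) v : (forall y, S y -> in_zeroset F y) -> in_zeroset F v ->
  forall D G, homd D G -> (forall y, S y -> G.@[y] = 0) -> G.@[v] != 0 ->
  exists D' g, [/\ (D' <= D)%N, homd D' g, forall y, S y -> g.@[y] = 0 & ~ I g].
Proof.
move=> hS hv; elim=> [|D IH] G hG GS Gv.
  exists 0%N, G; split=> //; rewrite I_adj => /(adj_hom J0_gideal hl hG) [b [_ /(_ isT) -> h]].
  move/eqP: Gv; apply; move: h; rewrite mul0r subr0; apply: (proj2 (J0_zero v)).
  by case: hv.
case: (classic (I G)) => [|nG]; last by exists D.+1, G.
rewrite I_adj => /(adj_hom J0_gideal hl hG) [b [hb _ h]]; rewrite subn1 /= in hb.
have ev w : in_zeroset F w -> G.@[w] = b.@[w] * l.@[w].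
  move=> hw; have := proj2 (J0_zero w) (proj2 hw) _ h.
  by rewrite mevalB mevalM => /eqP; rewrite subr_eq0 => /eqP.
have [|| D' [g [g1 g2 g3 g4]]] := IH b hb.
- move=> y hy; have /eqP := GS y hy; rewrite ev; last exact: hS.
  by rewrite mulf_eq0 (negbTE (lv (hS _ hy))) orbF => /eqP.
- by apply: contraNneq Gv => b0; rewrite ev // b0 mul0r.
- by exists D', g; split; [exact: leqW | exact: g2 | exact: g3 | rewrite -I_adj].
Qed.

Lemma phi_growth D g i : homd D g -> ~ I g -> (0 < D)%N -> (i < sigma_d d - D)%N ->
  phi d (D + i.+1) <= Posz (HF (colon I g) i.+1).
Proof.
move=> hg ng D0 hi.
have := principal_growth fs_form fs_size fs_mprim hg ng (i := i) fs_sorted.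
rewrite fs_sigma => /(_ hi); set r := HF _ _; rewrite fs_degrees => hr.
have hm : (2 <= D + i.+1 <= sigma_d d)%N by lia.
(* For [r <= n] the dropped list consists of the [n - r] smallest [d i] and the degree 1 of [l],
   which contributes 0; so [phi_le] applies with [t = n - r]. Otherwise [phi <= n] suffices. *)
case: (leqP r n) => rn.
  have := @phi_le n d (n - r) (D + i.+1) d1 (leq_subr _ _) hm.
  rewrite subKn //; apply; rewrite addnS /=; apply: leq_trans hr.
  rewrite -cats1 drop_cat size_rev size_map size_enum_ord.
  set ds := [seq d i | i <- enum 'I_n].
  have sds : size ds = n by rewrite size_map size_enum_ord.
  case: ltnP => rn'; last by rewrite (_ : (n - r = 0)%N) ?take0 ?big_nil //; lia.
  rewrite big_cat /= drop_rev sds.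
  by rewrite [X in (_ <= X + _)%N](perm_big (take (n - r) ds)) ?perm_rev ?leq_addr.
have := @phi_le n d 0 (D + i.+1) d1 (leq0n _) hm; rewrite take0 big_nil => /(_ isT) h.
by apply: le_trans h _; rewrite lez_nat subn0 ltnW.
Qed.

End Main.

Local Close Scope ring_scope.

Theorem theorem3p7 (k : closedFieldType) (n : nat) (d : 'I_n -> nat)
    (F : 'I_n -> {mpoly k[n.+1]}) (D : nat) (G : {mpoly k[n.+1]}) :
  (forall i, 1 <= d i) ->
  (forall i j : 'I_n, i <= j -> d i <= d j) ->
  reduced_complete_intersection d F ->
  1 <= D -> D < sigma_d d ->
  G != 0%R -> homog_of D G ->
  (exists s : seq ('I_n.+1 -> k),
      (forall i, (i < size s)%N ->
         in_zeroset F (nth (fun _ => 0%R) s i) /\ vanishes_at G (nth (fun _ => 0%R) s i)) /\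
      (forall i j, (i < size s)%N -> (j < size s)%N -> i <> j ->
         ~ proj_eq (nth (fun _ => 0%R) s i) (nth (fun _ => 0%R) s j)) /\
      (delta d D <= Posz (size s))%R) ->
  forall v, in_zeroset F v -> vanishes_at G v.
Proof.
move=> d1 dm [hF [z hz] _] D1 Ds _ hG [s [sv [sd sl]]] v hv.
apply/eqP/negPn/negP => /negP Gv.
have hJ := J0_gideal d1 hF.
(* The list [z] may contain the zero vector, which is replaced by the point with all coordinates
   1. *)
pose p (i : 'I_(size z)) : 'I_n.+1 -> k :=
  if excluded_middle_informative (ppoint (nth (fun _ => 0%R) z i))
  then nth (fun _ => 0%R) z i else fun _ => 1%R.
have pp i : ppoint (p i).
  by rewrite /p; case: excluded_middle_informative => //; exists ord0; exact: oner_neq0.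
have pc w : in_zeroset F w -> exists i, proj_eq (p i) w.
  move=> hw; have [i lt [c [c0 hc]]] := hz w hw; exists (Ordinal lt).
  rewrite /p /=; case: excluded_middle_informative => [h|no]; first by exists c.
  case: no; have [[a wa] _] := hw; exists a; apply: contraNneq wa => e.
  by rewrite hc e mulr0.
have [l hl lp] := linear_avoid pp.
have ml : mprim (adj (idl (@zeroid k n.+1) (Fforms d F)) l).
  apply: (mprim_avoid hJ hl) lp => w pw Jw; apply: pc; split=> //.
  exact/(J0_zero d1 hF).
have lv w : in_zeroset F w -> (l.@[w] != 0)%R.
  move=> /pc [i [c [c0 hc]]]; rewrite (meval_scale hc hl) expr1.
  by apply: mulf_neq0.
have ff := fs_form d1 hF hl; have fz := fs_size d F l; have fm := fs_mprim ml.
have hI := I_gideal ff.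
pose Y y := exists2 i, (i < size s)%N & y = nth (fun _ => 0%R) s i.
have YF y : Y y -> in_zeroset F y by move=> [i /sv [h _] ->].
have [||D' [g' [le hg' gY' ng']]] := descend d1 hF hl lv YF hv hG.
- by move=> y [i /sv [_ h] ->].
- exact/negP.
have dd := D_le ff fz fm hg' ng'; rewrite fs_sigma in dd.
(* Multiplying by [w] brings the degree back to [D] while staying nonzero modulo [I]. *)
have [|w [hw nw]] := principal_nz ff fz fm hg' ng' (i := D - D').
  by rewrite fs_sigma; lia.
set g := (g' * w)%R in nw.
have hg : homd D g by rewrite -(subnKC le); exact: homM.
have gY y : Y y -> g.@[y] = 0%R by move=> /gY' e; rewrite mevalM e mul0r.
pose K := sigma_d d - D.
pose h := HF (colon (idl (@zeroid k n.+1) (rcons (Fforms d F) (1, l))) g).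
pose B := (sigma_d d).+1 + size s.
pose y (i : 'I_(size s)) := nth (fun _ => 0%R) s i.
have yY i : Y (y i) by exists i.
have Jy u : adj (idl (@zeroid k n.+1) (Fforms d F)) g u -> forall i, u.@[y i] = 0%R.
  move=> [b hb] i; have [_ hF0] := YF _ (yY i).
  have := proj2 (J0_zero d1 hF (y i)) hF0 _ hb.
  by rewrite mevalB mevalM gY // mulr0 subr0.
have yd i j : i != j -> ~ proj_eq (y i) (y j).
  by move=> ij; apply: sd => // e; move: ij; rewrite (val_inj e) eqxx.
have count : size s <=
    \sum_(j < B) HF (adj (idl (@zeroid k n.+1) (rcons (Fforms d F) (1, l))) g) j.
  (* The points are zeros of [J0 + (g)] at which [l] does not vanish, so the forms [g] and [l] are
     exchanged. *)
  rewrite I_adj adjC; apply: (points_le (adj_gideal hJ hg) hl (ltn0Sn 0) _ yd Jy).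
  - by move=> i; case: (YF _ (yY i)).
  - by move=> i; apply: lv; exact: YF.
  - by rewrite /B.
  - exact: leq_addl.
have total := principal_sum ff fz hg B.
have [bez _] := I_ci ff fz fm.
have := bez B; rewrite -total fs_prod => {}bez.
have low : \sum_(i < K.+1) h i <= \sum_(i < B - D) h i.
  have -> : B - D = K.+1 + size s by rewrite /B /K; lia.
  by rewrite big_split_ord leq_addr.
have h0 : 0 < h 0.
  rewrite /h HF0_eq1 //; first exact: colon_gideal hI hg.
  by rewrite /colon mulr1.
have sym i : i <= K -> h i = h (K - i).
  by move=> hi; have := principal_sym ff fz fm hg nw (i := i); rewrite fs_sigma; apply.
(* The numbers of terms in the two sums of [delta]: they end at [D + a] and [D + b]. *)
pose a := K.-1./2; pose b := uphalf K.-1.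
have eK : K = (a + b).+1.
  by rewrite /a /b addnC uphalf_half -addnA addnn odd_double_half prednK // /K; lia.
have := half_sum h0 (a := a) (b := b); rewrite -eK => /(_ sym) half.
have ta : (sigma_d d + D - 1)./2 = D + a.
  rewrite /a; have -> : sigma_d d + D - 1 = D.*2 + K.-1 by rewrite /K; lia.
  by rewrite halfD odd_double doubleK.
have tb : uphalf (sigma_d d + D - 1) = D + b.
  rewrite /b; have -> : sigma_d d + D - 1 = D.*2 + K.-1 by rewrite /K; lia.
  by rewrite !uphalf_half oddD halfD odd_double doubleK /= add0n addnCA.
have sumc c : c <= K.-1 ->
  (\sum_(D.+1 <= m < (D + c).+1) phi d m <= Posz (\sum_(i < c) h i.+1))%R.
  move=> hc; rewrite -{1}[D.+1]add0n big_addn big_mkord subSS addKn.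
  apply: (sum_le_Posz (f := fun i => phi d (i + D.+1)) (h := fun i => h i.+1)) => i hi.
  rewrite addnS -addSn addnC; apply: phi_growth => //; rewrite -/K; lia.
have sa := sumc a; have sb := sumc b.
move: sl; rewrite /delta ta tb.
have {}sa : (\sum_(D.+1 <= m < (D + a).+1) phi d m <= Posz (\sum_(i < a) h i.+1))%R.
  by apply: sa; lia.
have {}sb : (\sum_(D.+1 <= m < (D + b).+1) phi d m <= Posz (\sum_(i < b) h i.+1))%R.
  by apply: sb; lia.
(* The number of points is at most the product of the [d i] minus the sum of [h], hence minus both
   half sums and 2, whereas [delta] subtracts only 1 besides sums that are no larger. *)
move: sa sb half low bez count.
move: (\sum_(_ <= m < (D + a).+1) _)%R (\sum_(_ <= m < (D + b).+1) _)%R => sa sb.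
move: (\sum_(i < a) _) (\sum_(i < b) _) (\sum_(i < K.+1) _) => A C E.
rewrite -/h; move: (\sum_(i < B - D) _) (\sum_(j < B) _) (\prod_(i < n) _) (size s) => T U V W.
lia.
Qed.
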